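(* Let $M$ be a compact manifold. If $X\in\mathfrak{X}^1(M)$ is a transitive, separating $C^1$ vector field, then $X$ has trivial $C^1$-centralizer, that is, $\{Y\in\mathfrak{X}^1(M):[X,Y]=0\}=\{cX: c\in\mathbb{R}\}$.
   Context: $M$ is a smooth, compact, boundaryless manifold of dimension $d\ge 2$ with a fixed Riemannian metric and induced distance $d(\cdot,\cdot)$. $\mathfrak{X}^1(M)$ is the space of $C^1$ vector fields on $M$ and $X_t$ denotes the flow of $X$. $[X,Y]=0$ is equivalent to commutation of the flows of $X$ and $Y$. $X$ is transitive if it has an orbit dense in $M$. $X$ is separating if there exists $\varepsilon>0$ such that whenever $x,y\in M$ satisfy $d(X_t(x),X_t(y))<\varepsilon$ for every $t\in\mathbb{R}$, then $y$ belongs to the $X$-orbit of $x$. *)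

(* Defs.v *)
From HB Require Import structures.
From mathcomp Require Import all_boot all_order all_algebra.
From mathcomp Require Import all_classical all_reals all_analysis.

Set Implicit Arguments.
Unset Strict Implicit.
Unset Printing Implicit Defensive.

Import Order.TTheory GRing.Theory Num.Theory.
Import numFieldNormedType.Exports.

Local Open Scope classical_set_scope.
Local Open Scope ring_scope.

(* [f] is of class C^k on the set [U], which is open in every use: the
   coordinates of the differential are [x |-> 'd f x v]. *)
Fixpoint Ck (R : realType) (V W : normedModType R) (k : nat) (U : set V)
    (f : V -> W) {struct k} : Prop :=
  match k with
  | 0 => forall x, U x -> {for x, continuous f}
  | k'.+1 => (forall x, U x -> differentiable f x) /\
             (forall v : V, Ck k' U (fun x => 'd f x v))
  end.

Definition Csmooth (R : realType) (V W : normedModType R) (U : set V)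
    (f : V -> W) : Prop := forall k, Ck k U f.

(* The values of [cmap] off [cdom] and of [cinv] off [cmap @` cdom] are
   irrelevant.  The image is open in R^d, so there is no boundary. *)
Record chart (R : realType) (d : nat) (M : topologicalType) := Chart {
  cdom : set M ;
  cmap : M -> 'rV[R]_d ;
  cinv : 'rV[R]_d -> M ;
  cdom_open : open cdom ;
  cimg_open : open (cmap @` cdom) ;
  cmapK : forall p, cdom p -> cinv (cmap p) = p ;
  cmap_continuous : forall p, cdom p -> {for p, continuous cmap} ;
  cinv_continuous : forall u, (cmap @` cdom) u -> {for u, continuous cinv}
}.

Definition transition (R : realType) (d : nat) (M : topologicalType)
    (a b : chart R d M) : 'rV[R]_d -> 'rV[R]_d := cmap b \o cinv a.

Record smooth_atlas (R : realType) (d : nat) (M : topologicalType) :=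
  SmoothAtlas {
  idx : Type ;
  at_chart : idx -> chart R d M ;
  idx_at : M -> idx ;
  idx_atP : forall p, cdom (at_chart (idx_at p)) p ;
  transition_smooth : forall i j,
    Csmooth (cmap (at_chart i) @` (cdom (at_chart i) `&` cdom (at_chart j)))
            (transition (at_chart i) (at_chart j))
}.

Arguments at_chart {R d M} A i : rename.
Arguments idx_at {R d M} A p : rename.

Section Manifold.
Variables (R : realType) (d : nat) (M : topologicalType).
Variable A : smooth_atlas R d M.

Local Notation dom i := (cdom (at_chart A i)).
Local Notation phi i := (cmap (at_chart A i)).
Local Notation psi i := (cinv (at_chart A i)).
Local Notation Dtrans i j p :=
  ('d (transition (at_chart A i) (at_chart A j)) (phi i p)).

(* A tangent vector at [p] is the family of its coordinates in all the charts
   around [p], related by the differentials of the transition maps.  The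
   coordinates in the other charts are set to 0, so that two tangent vectors
   at [p] are the same if and only if they are equal as functions. *)
Definition tangent_at (p : M) (v : idx A -> 'rV[R]_d) : Prop :=
  (forall i j, dom i p -> dom j p -> v j = Dtrans i j p (v i)) /\
  (forall i, ~ dom i p -> v i = 0).

Definition vfield := M -> idx A -> 'rV[R]_d.

Definition local_rep (X : vfield) (i : idx A) : 'rV[R]_d -> 'rV[R]_d :=
  fun u => X (psi i u) i.

Definition C1_vector_field (X : vfield) : Prop :=
  (forall p, tangent_at p (X p)) /\
  (forall i, Ck 1 (phi i @` dom i) (local_rep X i)).

(* [X, Y] = DY.X - DX.Y in every chart.  In a chart not containing [p],
   [X p i] and [Y p i] are 0 for vector fields, hence so is this value. *)
Definition lie_bracket (X Y : vfield) : vfield := fun p i =>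
  'd (local_rep Y i) (phi i p) (X p i) - 'd (local_rep X i) (phi i p) (Y p i).

Definition integral_curve (X : vfield) (c : R -> M) : Prop :=
  continuous c /\
  (forall t i, dom i (c t) -> is_derive t 1 (phi i \o c) (X (c t) i)).

(* [flow X t x] is X_t(x), the value at time [t] of the integral curve of [X]
   issued from [x].  On a compact Hausdorff manifold a C^1 vector field has
   exactly one such curve, defined for all times; the default value [x] of
   [xget] is then not used. *)
Definition flow (X : vfield) (t : R) (x : M) : M :=
  xget x [set y | exists c, [/\ integral_curve X c, c 0 = x & c t = y]].

Definition flow_orbit (X : vfield) (x : M) : set M := range (flow X ^~ x).

Definition transitive_field (X : vfield) : Prop :=
  exists x, dense (flow_orbit X x).

(* [g p i] is the Gram matrix at [p] of the coordinate frame of the chart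
   [i]; it is relevant only when [p] lies in the domain of this chart. *)
Definition metric_tensor := M -> idx A -> 'M[R]_d.

Definition riemannian (g : metric_tensor) : Prop :=
  [/\ (forall p i, dom i p -> (g p i)^T = g p i),
      (forall p i (v : 'rV[R]_d), dom i p -> v != 0 ->
         0 < (v *m g p i *m v^T) 0 0),
      (forall p i j (v w : 'rV[R]_d), dom i p -> dom j p ->
         v *m g p i *m w^T = Dtrans i j p v *m g p j *m (Dtrans i j p w)^T) &
      (forall i, Csmooth (phi i @` dom i) (fun u => g (psi i u) i))].

Definition velocity (c : R -> M) (t : R) : idx A -> 'rV[R]_d :=
  fun i => if `[< dom i (c t) >] then derive1 (phi i \o c) t else 0.

Definition tangent_norm (g : metric_tensor) (p : M) (v : idx A -> 'rV[R]_d) :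
    R :=
  let i := idx_at A p in Num.sqrt ((v i *m g p i *m (v i)^T) 0 0).

Definition C1_curve (c : R -> M) : Prop :=
  continuous c /\
  (forall t i, dom i (c t) ->
     derivable (phi i \o c) t 1 /\ {for t, continuous (derive1 (phi i \o c))}).

(* Only the restriction of [c] to [0, 1] matters.  A curve on a closed
   interval is C^1 (with one-sided derivatives at the endpoints) if and only
   if it is the restriction of a C^1 curve defined on the whole line. *)
Definition piecewise_C1_path (p q : M) (c : R -> M) : Prop :=
  [/\ c 0 = p, c 1 = q &
      exists2 s : seq R, itv_partition 0 1 s &
        forall k, (k < size s)%N ->
          exists2 e, C1_curve e &
            {in `[nth 0 (0 :: s) k, nth 0 (0 :: s) k.+1], c =1 e}].

Definition path_length (g : metric_tensor) (c : R -> M) : \bar R :=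
  (\int[lebesgue_measure]_(t in `[0%R, 1%R])
     (tangent_norm g (c t) (velocity c t))%:E)%E.

(* The value is +oo for points in distinct connected components. *)
Definition riemannian_dist (g : metric_tensor) (p q : M) : \bar R :=
  ereal_inf [set path_length g c | c in piecewise_C1_path p q].

Definition separating_field (g : metric_tensor) (X : vfield) : Prop :=
  exists2 eps : R, 0 < eps &
    forall x y : M,
      (forall t : R,
         (riemannian_dist g (flow X t x) (flow X t y) < eps%:E)%E) ->
      flow_orbit X x y.

Definition C1_centralizer (X : vfield) : set vfield :=
  [set Y | C1_vector_field Y /\ lie_bracket X Y = (fun _ _ => 0)].

Definition scale_field (c : R) (X : vfield) : vfield := fun p i => c *: X p i.

End Manifold.

(* Main.v *)
Require Import Defs.
From mathcomp Require Import all_boot all_order all_algebra.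
From mathcomp Require Import all_classical all_reals all_analysis.
From mathcomp Require Import measurable_realfun ring lra.
Set Implicit Arguments.
Unset Strict Implicit.
Unset Printing Implicit Defensive.
Import Order.TTheory GRing.Theory Num.Theory.
Import numFieldNormedType.Exports.
Local Open Scope classical_set_scope.
Local Open Scope ring_scope.

(** Let the X-orbit of [x0] be dense and let Y commute with X.  The flows
    commute ([flow_commute]), so that X_t(Y_s(x)) = Y_s(X_t(x)) stays at a
    distance O(|s|) from X_t(x), uniformly in t ([flow_dist_le]); for small s
    the separation property then puts Y_s(x0) on the X-orbit of [x0]
    ([commuting_orbit]).  There are uncountably many such s, whereas the times
    t with Y_s(x0) = X_t(x0) are distributed among countably many intervals of
    length e: two values of s share an interval, and their difference yields
    arbitrarily small pairs (s, t) with s nonzero and Y_s = X_t at every point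
    of the orbit ([small_coincidence]).  At each point x of the orbit this
    reads s Y(x) - t X(x) = o(|s| + |t|) ([first_order]).  At [x0], where X
    does not vanish since M is not a point ([zero_dense_orbit]), this forces
    t / s to converge to a constant c; then Y = cX along the whole orbit, with
    the same c ([proportional_on_orbit]), and everywhere by density.

    The flows rest on the following facts.  In a chart, Picard iteration solves
    the equation for a short time ([picard]); a field of class C^1 is made
    globally Lipschitz by truncating its argument ([C1_local_flow]).  Integral
    curves are unique ([solution_unique]), compactness gives a common existence
    time ([uniform_solution]), and curves are then prolonged to all times
    ([solution_all]).  All the comparisons of solutions are made on time
    intervals short with respect to the Lipschitz constant, on which the
    Gronwall inequality reduces to absorbing half of a supremum
    ([small_gronwall]).

    For a C^1 field the flow is only of class C^1, and its commutation with
    another flow is obtained without differentiating it in all directions: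
    when the bracket vanishes, X_t(Y_h(q)) - X_t(q) - h Y(X_t(q)), read in a
    chart, solves the linearized equation up to o(h), with an initial value
    which is also o(h) ([commute_estimate]).  Hence s |-> X_t(Y_s(q)) is an
    integral curve of Y, and uniqueness identifies it with Y_s(X_t(q)). *)

(** * Curves in a coordinate space *)

Lemma rV_norm_leP (R : realType) (d : nat) (v : 'rV[R]_d) (e : R) : 0 <= e ->
  `|v| <= e <-> forall j, `|v 0 j| <= e.
Proof.
move=> e0; rewrite [leLHS]/Num.Def.normr/= mx_normrE; split.
  move=> H j; apply: le_trans H.
  exact: (le_bigmax _ (fun ij : 'I_1 * 'I_d => `|v ij.1 ij.2|) (0, j)).
move=> H; rewrite (bigmax_le _ e0)//= => -[i j] _ /=.
by rewrite ord1; exact: H.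
Qed.

Lemma mx_coord_le (R : realType) (m n : nat) (v : 'M[R]_(m, n)) i j : `|v i j| <= `|v|.
Proof.
rewrite [leRHS]/Num.Def.normr/= mx_normrE.
exact: (le_bigmax _ (fun ij : 'I_m * 'I_n => `|v ij.1 ij.2|) (i, j)).
Qed.

(** The constant [C] spares rescaling [e] in limiting arguments. *)
Lemma le_of_le_eps (R : realType) (C x y : R) :
  (forall e, 0 < e -> x <= y + C * e) -> x <= y.
Proof.
move=> H; apply/ler_addgt0Pr => e e0.
have C1 : 0 < `|C| + 1 by rewrite ltr_wpDl.
have := H (e / (`|C| + 1)); rewrite divr_gt0// => /(_ isT)/le_trans; apply.
rewrite lerD2l mulrA ler_pdivrMr// mulrC ler_pM2l//.
by rewrite (le_trans (ler_norm _))// lerDl.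
Qed.

(** Estimates of this form, without quotients, are what the comparisons of
    integral curves produce and use. *)
Lemma is_derive_estP (R : realType) (V : normedModType R) (c : R -> V) (t : R) v :
  is_derive t 1 c v <-> forall e, 0 < e ->
    \forall s \near t, `|c s - c t - (s - t) *: v| <= e * `|s - t|.
Proof.
split=> [[dc <-] e e0|H].
  move/cvgrPdist_le : (dc) => /(_ e e0).
  rewrite -[lim _]/('D_1 c t) => /nbhs_ballP[r /= r0 Hr].
  apply/nbhs_ballP; exists r => //= s st.
  have [->|nst] := eqVneq s t; first by rewrite !subrr scale0r subr0 !normr0 mulr0.
  have st0 : s - t != 0 by rewrite subr_eq0.
  have := Hr (s - t); rewrite /ball/= sub0r normrN distrC => /(_ st st0) /=.
  rewrite /= [_%:A]mulr1 subrK => {}Hr.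
  have -> : c s - c t - (s - t) *: 'D_1 c t =
     (s - t) *: - ('D_1 c t - (s - t)^-1 *: (c s - c t)).
    by rewrite opprB scalerBr scalerA divff// scale1r.
  by rewrite normrZ mulrC (distrC t) ler_wpM2r// normrN.
suff cv : h^-1 *: (c (h *: 1 + t) - c t) @[h --> 0^'] --> v.
  by split; [apply/cvg_ex; exists v|exact/cvg_lim].
apply/cvgrPdist_le => e e0; have /nbhs_ballP[r /= r0 Hr] := H e e0.
apply/nbhs_ballP; exists r => //= h; rewrite /ball/= sub0r normrN => hr h0.
have := Hr (h + t); rewrite /ball/= opprD addrCA subrr addr0 normrN.
move=> /(_ hr); rewrite addrK => {}Hr.
rewrite [_%:A]mulr1.
have -> : v - h^-1 *: (c (h + t) - c t) =
     h^-1 *: - (c (h + t) - c t - h *: v).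
  by rewrite opprB [RHS]scalerBr scalerA mulVf// scale1r.
by rewrite normrZ normrN normfV mulrC ler_pdivrMr ?normr_gt0.
Qed.

Lemma is_derive_continuous (R : realType) (V : normedModType R) (c : R -> V) (t : R) v :
  is_derive t 1 c v -> {for t, continuous c}.
Proof. by move=> [/derivable1_diffP /differentiable_continuous]. Qed.

Lemma is_derive_coord (R : realType) (d : nat) (c : R -> 'rV[R]_d) (t : R) (v : 'rV[R]_d) j :
  is_derive t 1 c v -> is_derive t 1 (fun s => c s 0 j) (v 0 j).
Proof.
move=> /is_derive_estP H; apply/is_derive_estP => e e0.
near=> s; have : `|c s - c t - (s - t) *: v| <= e * `|s - t| by near: s; exact: H.
by move/(le_trans (mx_coord_le _ 0 j)); rewrite !mxE.
Unshelve. all: by end_near. Qed.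

Lemma is_derive_rV (R : realType) (d : nat) (c : R -> 'rV[R]_d) (t : R) (v : 'rV[R]_d) :
  (forall j, is_derive t 1 (fun s => c s 0 j) (v 0 j)) -> is_derive t 1 c v.
Proof.
move=> H; apply/is_derive_estP => e e0.
near=> s; apply/rV_norm_leP; first by rewrite mulr_ge0// ltW.
move=> j; rewrite !mxE; move: j; near: s; apply: filter_forall => j.
by have /is_derive_estP/(_ e e0) := H j.
Unshelve. all: by end_near. Qed.

Lemma is_derive_scalel (R : realType) (V : normedModType R) (x : V) (t : R) :
  is_derive t 1 (fun z : R => z *: x) x.
Proof.
apply/is_derive_estP => e e0; near=> y.
by rewrite -!scalerBl subrr scale0r normr0 mulr_ge0// ltW.
Unshelve. all: by end_near. Qed.

Lemma is_derive_chain (R : realType) (V W : normedModType R) (c : R -> V)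
    (f : V -> W) (t : R) v :
  is_derive t 1 c v -> differentiable f (c t) ->
  is_derive t 1 (f \o c) ('d f (c t) v).
Proof.
move=> [dc <-] df.
have dc' : differentiable c t by exact/derivable1_diffP.
have dfc : differentiable (f \o c) t by exact: differentiable_comp.
split; first exact/derivable1_diffP.
by rewrite deriveE// diff_comp// deriveE.
Qed.

Lemma mean_value_le (R : realType) (d : nat) (c dc : R -> 'rV[R]_d) K (a b : R) :
  a <= b ->
  (forall t, a <= t <= b -> is_derive t 1 c (dc t)) ->
  (forall t, a <= t <= b -> `|dc t| <= K) ->
  `|c b - c a| <= K * (b - a).
Proof.
move=> ab Hd HK.
have K0 : 0 <= K by rewrite (le_trans _ (HK a _))// lexx.
apply/rV_norm_leP; first by rewrite mulr_ge0// subr_ge0.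
move=> j; rewrite !mxE.
have [||r rab ->] := @MVT_segment R (fun s => c s 0 j) (fun s => dc s 0 j) a b ab.
- by move=> t; rewrite in_itv/= => /andP[/ltW at_ /ltW tb];
    apply: is_derive_coord; apply: Hd; rewrite at_.
- apply: derivable_within_continuous => t; rewrite in_itv/= => tab.
  by have [] := is_derive_coord j (Hd _ tab).
- move: rab; rewrite in_itv/= => rab.
  rewrite normrM (ger0_norm (_ : 0 <= b - a)) ?subr_ge0//.
  rewrite ler_wpM2r ?subr_ge0//.
  exact: le_trans (mx_coord_le _ _ _) (HK _ rab).
Qed.

Lemma lipschitz_of_deriv (R : realType) (d : nat) (c dc : R -> 'rV[R]_d) K (t0 T : R) :
  (forall t, `|t - t0| <= T -> is_derive t 1 c (dc t)) ->
  (forall t, `|t - t0| <= T -> `|dc t| <= K) ->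
  forall s t, `|s - t0| <= T -> `|t - t0| <= T -> `|c s - c t| <= K * `|s - t|.
Proof.
move=> Hd HK.
suff H s t : s <= t -> `|s - t0| <= T -> `|t - t0| <= T ->
    `|c s - c t| <= K * `|s - t|.
  move=> s t; have [st|/ltW ts] := leP s t; first exact: H.
  by move=> *; rewrite distrC (distrC s); exact: H.
move=> st sT tT; rewrite distrC (distrC s) (ger0_norm (_ : 0 <= t - s)) ?subr_ge0//.
have HI r : s <= r <= t -> `|r - t0| <= T.
  by move: sT tT; rewrite !ler_norml; lra.
by apply: (mean_value_le (dc := dc)) => // r /HI; [exact: Hd|exact: HK].
Qed.

(** Let [m] be the maximum of |w|.  Since |w'| <= L m + K, integrating over a time
    at most [T] gives m <= |w t0| + (L m + K) T <= |w t0| + m / 2 + K T.  No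
    exponential appears because [T] is small with respect to [1 / L]. *)
Lemma small_gronwall (R : realType) (d : nat) (w dw : R -> 'rV[R]_d) L K (t0 T : R) :
  0 <= L -> 0 <= K -> 0 <= T -> L * T <= 2^-1 ->
  (forall t, `|t - t0| <= T -> is_derive t 1 w (dw t)) ->
  (forall t, `|t - t0| <= T -> `|dw t| <= L * `|w t| + K) ->
  forall t, `|t - t0| <= T -> `|w t| <= 2 * (`|w t0| + K * T).
Proof.
move=> L0 K0 T0 LT Hd Hdw.
have [||m mI Hm] := @EVT_max R (fun t => `|w t|) (t0 - T) (t0 + T).
- by lra.
- apply: continuous_in_subspaceT => t; rewrite inE/= in_itv/= => tI.
  apply: (@continuous_comp _ _ _ w Num.norm); last exact: norm_continuous.
  by apply: is_derive_continuous (Hd t _); rewrite ler_norml; lra.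
have {}mI : `|m - t0| <= T by move: mI; rewrite in_itv/= ler_norml; lra.
have {}Hm t : `|t - t0| <= T -> `|w t| <= `|w m|.
  by move=> tT; apply: Hm; rewrite in_itv/=; move: tT; rewrite ler_norml; lra.
have H1 : `|w m - w t0| <= (L * `|w m| + K) * `|m - t0|.
  apply: (lipschitz_of_deriv (T := T) (dc := dw) Hd) => //; last by rewrite subrr normr0.
  move=> t tT; apply: le_trans (Hdw t tT) _.
  by rewrite lerD2r ler_wpM2l// Hm.
have H2 : `|w m| <= `|w t0| + (L * `|w m| + K) * T.
  rewrite -lerBlDl (le_trans (lerB_dist _ _))// (le_trans H1)//.
  by rewrite ler_wpM2l// addr_ge0// mulr_ge0.
move=> t /Hm/le_trans; apply.
have : L * `|w m| * T <= 2^-1 * `|w m| by rewrite mulrAC ler_wpM2r.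
move: H2; rewrite mulrDl; lra.
Qed.

(** * Neighbourhoods and compactness *)

Lemma near_dist_lt (R : realType) (T : topologicalType) (V : normedModType R)
    (c : T -> V) t e :
  {for t, continuous c} -> 0 < e -> \forall s \near t, `|c s - c t| < e.
Proof.
move=> ct e0; near=> s; rewrite distrC; near: s.
exact: cvgr_dist_lt _ _ ct _ e0.
Unshelve. all: by end_near. Qed.

Lemma near_dist_id (R : realType) (V : normedModType R) (t : V) (e : R) :
  0 < e -> \forall s \near t, `|s - t| < e.
Proof. exact: (near_dist_lt (c := id) cvg_id). Qed.

Lemma continuous_rV (R : realType) (T : topologicalType) (d : nat)
    (c : T -> 'rV[R]_d) t :
  (forall j, {for t, continuous (fun s => c s 0 j)}) -> {for t, continuous c}.
Proof.
move=> H; apply/cvgrPdist_le => e e0; near=> s.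
apply/rV_norm_leP; first exact: ltW.
move=> j; rewrite !mxE distrC; move: j; near: s; apply: filter_forall => j.
by apply: filterS (near_dist_lt (H j) e0) => s /ltW.
Unshelve. all: by end_near. Qed.

Lemma near_norm_lt (R : realType) (t T : R) : `|t| < T -> \forall s \near t, `|s| < T.
Proof. move=> tT; exact: (@cvgr_norm_lt _ _ _ (nbhs t) _ id t cvg_id T tT). Qed.

Lemma lipschitz_continuous (R : realType) (V W : normedModType R) (F : V -> W)
    (L : R) :
  0 <= L -> (forall x y, `|F x - F y| <= L * `|x - y|) -> continuous F.
Proof.
move=> L0 HL x; apply/cvgrPdist_le => e e0.
have L1 : 0 < L + 1 by lra.
near=> y; apply: le_trans (HL _ _) _.
have : `|y - x| <= e / (L + 1).
  by apply: ltW; near: y; apply: near_dist_id; rewrite divr_gt0.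
rewrite ler_pdivlMr// distrC; have := normr_ge0 (y - x); rewrite distrC; lra.
Unshelve. all: by end_near. Qed.

Lemma nbhs_norm_le (R : realType) (V : normedModType R) (x : V) (P : set V) :
  nbhs x P -> exists2 r : R, 0 < r & forall y, `|y - x| <= r -> P y.
Proof.
move=> /nbhs_ballP[r /= r0 Hr]; exists (r / 2); first by rewrite divr_gt0.
move=> y yr; apply: Hr.
by rewrite -ball_normE/= distrC (le_lt_trans yr)// ltr_pdivrMr// ltr_pMr// ltr1n.
Qed.

Lemma norm_le_sub (R : realType) (V : normedModType R) (a b : V) :
  `|a| <= `|a - b| + `|b|.
Proof. by rewrite -lerBlDr lerB_dist. Qed.

(** The form in which compactness provides uniform existence times, uniform
    moduli of differentiability and uniform bounds on functions. *)
Lemma compact_uniform (R : realType) (T : topologicalType) (K : set T)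
    (P : R -> T -> Prop) :
  compact K ->
  (forall r r' x, r <= r' -> P r' x -> P r x) ->
  (forall x, K x -> exists2 r, 0 < r & \forall y \near x, P r y) ->
  exists2 r, 0 < r & forall x, K x -> P r x.
Proof.
move=> /compact_near_coveringP cK Pmono Ploc.
have Pnear : \forall r \near (0 : R)^'+, K `<=` P r.
  apply: cK => x Kx; have [r r0 Pr] := Ploc x Kx.
  exists ([set y | P r y], [set r' | r' < r]) => /=.
    by split; [exact: Pr|exact: nbhs_right_lt].
  by move=> [y r'] /= [Py r'r]; exact: Pmono (ltW r'r) Py.
have Pr : \forall r \near (0 : R)^'+, K `<=` P r /\ 0 < r.
  by apply: filterS2 Pnear (nbhs_right_gt 0) => r KP r0; split.
by have [r [KP r0]] := @filter_ex _ (0 : R)^'+ _ _ Pr; exists r.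
Qed.

Lemma continuous_near_eq (T U : topologicalType) (f g : T -> U) t :
  (\forall s \near t, f s = g s) -> {for t, continuous f} -> {for t, continuous g}.
Proof.
move=> E cf; rewrite /prop_for /continuous_at -(nbhs_singleton E).
by apply: cvg_trans cf; apply: near_eq_cvg.
Qed.

(** * Picard iteration *)

(** The retraction of the line onto the interval of centre [a] and radius [r];
    applied to each coordinate it retracts onto a ball of the sup norm. *)
Definition clamp (R : realType) (a r x : R) : R :=
  Num.max (a - r) (Num.min (a + r) x).

Lemma max_dist (R : realType) (a x y : R) : `|Num.max a x - Num.max a y| <= `|x - y|.
Proof.
wlog xy : x y / x <= y.
  move=> H; have [|/ltW] := leP x y; first exact: H.
  by rewrite distrC (distrC x); exact: H.
rewrite distrC (distrC x) (ger0_norm (_ : 0 <= y - x)) ?subr_ge0// ler_norml.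
by have [?|?] := leP a x; have [?|?] := leP a y; apply/andP; split; lra.
Qed.

Lemma min_dist (R : realType) (a x y : R) : `|Num.min a x - Num.min a y| <= `|x - y|.
Proof.
wlog xy : x y / x <= y.
  move=> H; have [|/ltW] := leP x y; first exact: H.
  by rewrite distrC (distrC x); exact: H.
rewrite distrC (distrC x) (ger0_norm (_ : 0 <= y - x)) ?subr_ge0// ler_norml.
by have [?|?] := leP a x; have [?|?] := leP a y; apply/andP; split; lra.
Qed.

Lemma clamp_dist (R : realType) (a r x y : R) :
  `|clamp a r x - clamp a r y| <= `|x - y|.
Proof. exact: le_trans (max_dist _ _ _) (min_dist _ _ _). Qed.

Lemma clamp_in (R : realType) (a r x : R) : 0 <= r -> `|clamp a r x - a| <= r.
Proof.
rewrite /clamp => r0; rewrite ler_norml.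
by have [?|?] := leP (a + r) x;
  [have [?|?] := leP (a - r) (a + r)|have [?|?] := leP (a - r) x];
  apply/andP; split; lra.
Qed.

Lemma clamp_id (R : realType) (a r x : R) : `|x - a| <= r -> clamp a r x = x.
Proof.
rewrite /clamp ler_norml => /andP[H1 H2].
by rewrite min_r ?max_r//; lra.
Qed.

Lemma clamp_continuous (R : realType) (a r : R) : continuous (clamp a r).
Proof.
move=> x; apply/cvgrPdist_le => e e0.
near=> y; apply: le_trans (clamp_dist _ _ _ _) _.
near: y; have /cvgrPdist_le := @cvg_id _ (nbhs x); exact.
Unshelve. all: by end_near. Qed.

(** Integrating from a point left of -T gives a two-sided derivative on the
    whole of ]-T, T[; clamping the argument makes the primitive continuous on the
    line, as iterating the construction requires. *)
Lemma antiderivative_R (R : realType) (h : R -> R) (T : R) : 0 < T ->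
  continuous h ->
  exists H : R -> R, [/\ continuous H, H 0 = 0 &
    forall t : R, `|t| < T -> is_derive t 1 H (h t)].
Proof.
move=> T0 ch; pose T1 := T + 1.
pose F y := (\int[lebesgue_measure]_(t in `[(- T1), y]) h t)%R.
have dF (t : R) : `|t| < T1 -> is_derive t 1 F (h t).
  rewrite ltr_norml => tT.
  have [||||dF F't] := @continuous_FTC1_closed R h (- T1) t T1.
  - lra.
  - apply: continuous_compact_integrable; first exact: segment_compact.
    exact: continuous_subspaceT.
  - lra.
  - exact: ch.
  by rewrite derive1E in F't; apply: DeriveDef; [exact: dF|exact: F't].
exists (fun x => F (clamp 0 T x) - F 0); split.
- move=> t; apply: cvgB; last exact: cvg_cst.
  apply: continuous_comp; first exact: clamp_continuous.
  apply: (is_derive_continuous (v := h (clamp 0 T t))); apply: dF.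
  by have := clamp_in 0 t (ltW T0); rewrite subr0 /T1; lra.
- by rewrite clamp_id ?subrr ?subr0 ?normr0 ?ltW.
- move=> t tT.
  apply: (@near_eq_is_derive _ _ _ (fun x => F x - F 0)); last first.
    rewrite -[h t]subr0.
    have dFt : is_derive t 1 F (h t) by apply: dF; rewrite /T1; lra.
    exact: (is_deriveB dFt (is_derive_cst (F 0) t 1)).
  have : \forall x \near t, `|x| < T by exact: (@cvgr_norm_lt _ _ _ (nbhs t) _ id t cvg_id T tT).
  by apply: filterS => x /ltW xT; rewrite clamp_id// subr0.
Qed.

Lemma antiderivative_rV (R : realType) (d : nat) (h : R -> 'rV[R]_d) (T : R) :
  0 < T -> continuous h ->
  exists H : R -> 'rV[R]_d, [/\ continuous H, H 0 = 0 &
    forall t : R, `|t| < T -> is_derive t 1 H (h t)].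
Proof.
move=> T0 ch.
have cj j : continuous (fun s => h s 0 j).
  move=> t; apply: (@continuous_comp _ _ _ h (fun v : 'rV[R]_d => v 0 j) t (ch t)).
  exact: coord_continuous.
have /choice[H HH] j := antiderivative_R T0 (cj j).
exists (fun t => \row_j H j t); split.
- move=> t; apply: continuous_rV => j.
  have -> : (fun s => (\row_j0 H j0 s) 0 j) = H j.
    by apply/funext => s; rewrite mxE.
  by have [cH _ _] := HH j; exact: cH.
- by apply/rowP => j; rewrite !mxE; have [] := HH j.
- move=> t tT; apply: is_derive_rV => j.
  have -> : (fun s => (\row_j0 H j0 s) 0 j) = H j.
    by apply/funext => s; rewrite mxE.
  by have [_ _] := HH j; exact.
Qed.

(** Summing the geometric series bounds the distance to the limit by twice the
    size of the next increment. *)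
Lemma geometric_limit (R : realType) (d : nat) (x : nat -> 'rV[R]_d) (C : R) :
  0 <= C -> (forall n, `|x n.+1 - x n| <= C * 2^-1 ^+ n) ->
  exists l, forall n, `|x n - l| <= 2 * C * 2^-1 ^+ n.
Proof.
move=> C0 Hx.
have Hk n k : `|x (n + k)%N - x n| <= 2 * C * 2^-1 ^+ n - 2 * C * 2^-1 ^+ (n + k).
  elim: k => [|k IH]; first by rewrite addn0 !subrr normr0.
  rewrite addnS exprS (le_trans (ler_distD (x (n + k)%N) _ _))//.
  by have := lerD (Hx (n + k)%N) IH; lra.
have {}Hk n m : (n <= m)%N -> `|x m - x n| <= 2 * C * 2^-1 ^+ n.
  move=> nm; have := Hk n (m - n)%N; rewrite subnKC// => /le_trans; apply.
  by rewrite gerBl mulr_ge0 ?exprn_ge0// mulr_ge0.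
have small e : 0 < e -> \forall n \near \oo, 2 * C * 2^-1 ^+ n < e.
  move=> e0.
  have /cvgr_dist_lt/(_ _ e0) : geometric (2 * C) (2^-1 : R) n @[n --> \oo] --> 0.
    by apply: cvg_geometric; rewrite ger0_norm; lra.
  by apply: filterS => n; rewrite /geometric/= sub0r normrN; exact: le_lt_trans (ler_norm _).
have /cauchy_cvg xl : cauchy (x @ \oo).
  apply/cauchyP => e e0; have /= [N _ HN] := small e e0.
  exists (x N); exists N => // n /= Nn.
  rewrite -ball_normE/= distrC; apply: le_lt_trans (Hk _ _ Nn) _.
  exact: HN (leqnn N).
exists (lim (x @ \oo)) => n.
rewrite distrC.
apply: (@le_of_le_eps R 1) => e e0.
have /= [N _ HN] := cvgr_dist_lt _ _ xl _ e0.
have Nm : (N <= maxn N n)%N by exact: leq_maxl.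
rewrite (le_trans (ler_distD (x (maxn N n)) _ _))// addrC mul1r.
by apply: lerD; [exact: Hk (leq_maxr _ _)|exact: ltW (HN _ Nm)].
Qed.

(** Since L T <= 1/2, each iteration halves the distance between successive
    iterates.  The limit [c] satisfies |c s - c t - (s - t) F(c t)| <= L B |s - t|^2,
    by passing to the limit in the mean value inequality for the iterates, so it
    is differentiable with the expected derivative. *)
Lemma picard (R : realType) (d : nat) (F : 'rV[R]_d -> 'rV[R]_d) (L B T : R) u :
  0 <= L -> 0 < T -> L * T <= 2^-1 ->
  (forall x y, `|F x - F y| <= L * `|x - y|) -> (forall x, `|F x| <= B) ->
  exists c : R -> 'rV[R]_d, [/\ c 0 = u,
     forall t : R, `|t| < T -> is_derive t 1 c (F (c t)) &
     forall t : R, `|t| < T -> `|c t - u| <= B * T].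
Proof.
move=> L0 T0 LT HL HB.
have cF : continuous F by exact: lipschitz_continuous HL.
have B0 : 0 <= B := le_trans (normr_ge0 _) (HB 0).
have /choice[Phi HPhi] : forall g : R -> 'rV[R]_d, exists g' : R -> 'rV[R]_d,
    continuous g -> [/\ continuous g', g' 0 = u &
      forall t : R, `|t| < T + 1 -> is_derive t 1 g' (F (g t))].
  move=> g; have [cg|ncg] := pselect (continuous g); last by exists g => /ncg.
  have cFg : continuous (F \o g) by move=> t; apply: continuous_comp (cg t) (cF _).
  have T1 : 0 < T + 1 by lra.
  have [H [cH H0 dH]] := antiderivative_rV T1 cFg.
  exists (fun t => u + H t) => _; split.
  - by move=> t; apply: cvgD; [exact: cvg_cst|exact: cH].
  - by rewrite H0 addr0.
  - move=> t tT; rewrite -[F (g t)]add0r.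
    exact: (is_deriveD (is_derive_cst u t 1) (dH t tT)).
pose g n := iter n Phi (cst u).
have cg n : continuous (g n).
  elim: n => [|n IH]; first by move=> t; exact: cvg_cst.
  by have [] := HPhi _ IH.
have g0 n : g n 0 = u.
  by case: n => [//|n]; have [] := HPhi _ (cg n).
have dg n (t : R) : `|t| <= T -> is_derive t 1 (g n.+1) (F (g n t)).
  by move=> tT; have [_ _] := HPhi _ (cg n); apply; lra.
have dg' n (t : R) : `|t - 0| <= T -> is_derive t 1 (g n.+1) (F (g n t)).
  by rewrite subr0; exact: dg.
have T00 : `|0 - 0 : R| <= T by rewrite subrr normr0 ltW.
have lipg n s t : `|s| <= T -> `|t| <= T -> `|g n s - g n t| <= B * `|s - t|.
  case: n => [|n] sT tT; first by rewrite subrr normr0 mulr_ge0.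
  by apply: (lipschitz_of_deriv (dg' n)); rewrite ?subr0.
have step n t : `|t| <= T -> `|g n.+1 t - g n t| <= B * T * 2^-1 ^+ n.
  elim: n t => [|n IH] t tT.
    rewrite expr0 mulr1 -[g 0 t]/u -(g0 1%N).
    apply: le_trans (lipg _ _ _ tT _) _; first by rewrite normr0 ltW.
    by rewrite subr0 ler_wpM2l.
  pose w s := g n.+2 s - g n.+1 s.
  have -> : g n.+2 t - g n.+1 t = w t - w 0 by rewrite /w !g0 subrr subr0.
  apply: le_trans
    (lipschitz_of_deriv (T := T) (t0 := 0) (K := L * (B * T * 2^-1 ^+ n))
       (dc := fun s => F (g n.+1 s) - F (g n s)) _ _ _ _) _.
  - by move=> s sT; exact: (is_deriveB (dg' n.+1 s sT) (dg' n s sT)).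
  - move=> s; rewrite subr0 => sT; apply: le_trans (HL _ _) _.
    by rewrite ler_wpM2l// IH.
  - by rewrite subr0.
  - by [].
  rewrite subr0 exprS.
  have P0 : 0 <= B * T * 2^-1 ^+ n by rewrite !mulr_ge0// ?exprn_ge0// ltW.
  have := ler_wpM2r P0 LT.
  have : L * (B * T * 2^-1 ^+ n) * `|t| <= L * (B * T * 2^-1 ^+ n) * T.
    by rewrite ler_wpM2l// mulr_ge0.
  lra.
have BT0 : 0 <= B * T by rewrite mulr_ge0// ltW.
have /choice[c Hc] : forall t, exists l, `|t| <= T ->
    forall n, `|g n t - l| <= 2 * (B * T) * 2^-1 ^+ n.
  move=> t; have [tT|nT] := boolP (`|t| <= T); last by exists 0.
  by have [l Hl] := geometric_limit BT0 (fun n => step n t tT); exists l.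
pose eps n := 2 * (B * T) * 2^-1 ^+ n : R.
have eps_small e : 0 < e -> exists n, eps n <= e.
  move=> e0.
  have /cvgr_dist_lt/(_ _ e0) : geometric (2 * (B * T)) (2^-1 : R) n @[n --> \oo] --> 0.
    by apply: cvg_geometric; rewrite ger0_norm; lra.
  move=> -[N _ /(_ N (leqnn N))]; rewrite /geometric/= sub0r normrN => H.
  by exists N; exact: le_trans (ler_norm _) (ltW H).
have lipc s t : `|s| <= T -> `|t| <= T -> `|c s - c t| <= B * `|s - t|.
  move=> sT tT; apply: (@le_of_le_eps R 2) => e /eps_small[n en].
  have := Hc s sT n; have := Hc t tT n; rewrite -/(eps n) => H1 H2.
  have := lipg n s t sT tT; rewrite distrC in H2.
  have := ler_distD (g n s) (c s) (c t); have := ler_distD (g n t) (g n s) (c t).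
  lra.
have c0 : c 0 = u.
  apply/eqP; rewrite -subr_eq0 -normr_le0; apply: (@le_of_le_eps R 1) => e /eps_small[n en].
  have := Hc 0; rewrite normr0 => /(_ (ltW T0) n); rewrite g0 -/(eps n) distrC; lra.
(* At the n-th stage the error is of order 2 ^ -n; then n tends to infinity. *)
have quad s t : `|s| <= T -> `|t| <= T ->
    `|c s - c t - (s - t) *: F (c t)| <= L * B * `|s - t| * `|s - t|.
  move=> sT tT; apply: (@le_of_le_eps R (L * `|s - t| + 2)) => e /eps_small[n en].
  pose m := (s + t) / 2; pose r := `|s - t| / 2.
  have near_t z : `|z - m| <= r -> `|z| <= T /\ `|z - t| <= `|s - t|.
    move: sT tT; rewrite /m /r !ler_norml; have := ler_norm (s - t).
    have := ler_norm (- (s - t)); rewrite normrN.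
    by have [st|st] := ger0P (s - t); lra.
  have sm : `|s - m| <= r.
    by rewrite /r /m; have [st|st] := ger0P (s - t); rewrite ler_norml; lra.
  have tm : `|t - m| <= r.
    by rewrite /r /m; have [st|st] := ger0P (s - t); rewrite ler_norml; lra.
  pose w z := g n.+1 z - z *: F (c t).
  have : `|w s - w t| <= L * (eps n + B * `|s - t|) * `|s - t|.
    apply: (lipschitz_of_deriv (T := r) (t0 := m) (dc := fun z => F (g n z) - F (c t))) => //.
    - move=> z /near_t[zT _].
      exact: (is_deriveB (dg n z zT) (is_derive_scalel _ _)).
    - move=> z /near_t[zT zt]; apply: le_trans (HL _ _) _; rewrite ler_wpM2l//.
      rewrite (le_trans (ler_distD (c z) _ _))// lerD//; first exact: Hc.
      by rewrite (le_trans (lipc _ _ zT tT))// ler_wpM2l.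
  have -> : w s - w t = g n.+1 s - g n.+1 t - (s - t) *: F (c t).
    by apply/rowP => j; rewrite /w !mxE; ring.
  have e1 : eps n.+1 <= eps n.
    rewrite /eps exprS; have : 0 <= 2 * (B * T) * 2^-1 ^+ n.
      by rewrite mulr_ge0 ?exprn_ge0// mulr_ge0.
    lra.
  have := Hc s sT n.+1; have := Hc t tT n.+1; rewrite -/(eps n.+1) => H1 H2 H3.
  have -> : c s - c t - (s - t) *: F (c t) =
     (g n.+1 s - g n.+1 t - (s - t) *: F (c t)) + (g n.+1 t - c t) - (g n.+1 s - c s).
    by apply/rowP => j; rewrite !mxE; ring.
  have := ler_normB (g n.+1 s - g n.+1 t - (s - t) *: F (c t) + (g n.+1 t - c t)) (g n.+1 s - c s).
  have := ler_normD (g n.+1 s - g n.+1 t - (s - t) *: F (c t)) (g n.+1 t - c t).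
  have : L * `|s - t| * eps n <= L * `|s - t| * e by rewrite ler_wpM2l// mulr_ge0.
  have := normr_ge0 (s - t).
  lra.
exists c; split=> //.
- move=> t tT; apply/is_derive_estP => e e0.
  have LB : 0 < L * B + 1 by rewrite ltr_wpDl// mulr_ge0.
  near=> s.
  have sT : `|s| <= T.
    apply: ltW; near: s.
    exact: (@cvgr_norm_lt _ _ _ (nbhs t) _ id t cvg_id T tT).
  apply: le_trans (quad _ _ sT (ltW tT)) _; rewrite ler_wpM2r//.
  have : `|s - t| <= e / (L * B + 1).
    by apply: ltW; near: s; apply: (@near_dist_id _ R^o); rewrite divr_gt0.
  by rewrite ler_pdivlMr//; have := normr_ge0 (s - t); lra.
- move=> t /ltW tT; rewrite -c0; apply: le_trans (lipc _ _ tT _) _.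
    by rewrite normr0 ltW.
  by rewrite subr0 ler_wpM2l.
Unshelve. all: by end_near. Qed.

(** * Fields of class C^1 in a coordinate space *)

Lemma linear_bound (R : realType) (d : nat) (phi : 'rV[R]_d -> 'rV[R]_d)
    (w : 'I_d -> 'rV[R]_d) :
  (forall v, phi v = \sum_j v 0 j *: w j) ->
  forall v, `|phi v| <= (\sum_j `|w j|) * `|v|.
Proof.
move=> E v; rewrite E mulr_suml; apply: le_trans (ler_norm_sum _ _ _) _.
by apply: ler_sum => j _; rewrite normrZ mulrC ler_wpM2l// mx_coord_le.
Qed.

Lemma diff_delta (R : realType) (d : nat) (f : 'rV[R]_d -> 'rV[R]_d) (x v : 'rV[R]_d) :
  'd f x v = \sum_j v 0 j *: 'd f x (delta_mx 0 j).
Proof.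
have E : v = \sum_j v 0 j *: delta_mx 0 j by exact: row_sum_delta.
transitivity ('d f x (\sum_j v 0 j *: delta_mx 0 j)); first by congr ('d f x _).
rewrite linear_sum; apply: eq_bigr => j _.
by rewrite linearZ.
Qed.

Section C1_estimates.
Variables (R : realType) (d : nat) (U : set 'rV[R]_d) (f : 'rV[R]_d -> 'rV[R]_d).
Hypotheses (oU : open U) (C1f : Ck 1 U f).

(** The operator norm is controlled by the values on the finitely many basis
    vectors, each of which depends continuously on the base point. *)
Lemma C1_diff_near u0 e : U u0 -> 0 < e -> exists2 r, 0 < r &
  forall x, `|x - u0| <= r -> U x /\ forall v, `|'d f x v - 'd f u0 v| <= e * `|v|.
Proof.
move=> Uu e0; pose eta := e / d.+1%:R.
have eta0 : 0 < eta by rewrite divr_gt0.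
have nU : nbhs u0 U by exact: open_nbhs_nbhs.
pose close j x := `|'d f x (delta_mx 0 j) - 'd f u0 (delta_mx 0 j)| < eta.
have nD := @filter_forall _ 'I_d close (nbhs u0) (nbhs_filter u0).
have {}nD : nbhs u0 (fun x => forall j, close j x).
  apply: nD => j.
  by have [_ /(_ (delta_mx 0 j) u0 Uu) cj] := C1f; exact: (near_dist_lt cj eta0).
have [r r0 Hr] := nbhs_norm_le (filterI nU nD); exists r => // x /Hr[Ux Hx].
split=> // v.
pose w j := 'd f x (delta_mx 0 j) - 'd f u0 (delta_mx 0 j).
have E v' : 'd f x v' - 'd f u0 v' = \sum_j v' 0 j *: w j.
  transitivity (\sum_j (v' 0 j *: 'd f x (delta_mx 0 j) -
                        v' 0 j *: 'd f u0 (delta_mx 0 j))).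
    by rewrite sumrB; congr (_ - _); exact: diff_delta.
  by apply: eq_bigr => j _; rewrite scalerBr.
apply: (le_trans (linear_bound E v)); rewrite ler_wpM2r//.
apply: (@le_trans _ _ (\sum_(j < d) eta)); first by apply: ler_sum => j _; exact: ltW (Hx j).
rewrite sumr_const card_ord -mulr_natr /eta mulrAC ler_pdivrMr// ler_wpM2l ?ltW//.
by rewrite ltr_nat.
Qed.

(** The mean value inequality along the segment from [a] to [b], applied to [f]
    minus its differential at [a]. *)
Lemma C1_strict u0 e : U u0 -> 0 < e -> exists2 r, 0 < r &
  forall a b, `|a - u0| <= r -> `|b - u0| <= r ->
    `|f b - f a - 'd f a (b - a)| <= e * `|b - a|.
Proof.
move=> Uu e0; have e20 : 0 < e / 2 by rewrite divr_gt0.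
have [r r0 Hr] := C1_diff_near Uu e20; exists r => // a b ar br.
pose p s : 'rV[R]_d := a + s *: (b - a).
pose w s := f (p s) - s *: 'd f a (b - a).
have pr s : 0 <= s <= 1 -> `|p s - u0| <= r.
  move=> /andP[s0 s1].
  have -> : p s - u0 = (1 - s) *: (a - u0) + s *: (b - u0).
    by apply/rowP => j; rewrite /p !mxE; ring.
  rewrite (le_trans (ler_normD _ _))// !normrZ ger0_norm ?subr_ge0// ger0_norm//.
  have : (1 - s) * `|a - u0| <= (1 - s) * r by rewrite ler_wpM2l// subr_ge0.
  have : s * `|b - u0| <= s * r by rewrite ler_wpM2l.
  lra.
have dp (s : R) : is_derive s 1 p (b - a).
  apply/is_derive_estP => e1 e10; near=> y.
  have -> : p y - p s - (y - s) *: (b - a) = 0.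
    by apply/rowP => j; rewrite /p !mxE; ring.
  by rewrite normr0 mulr_ge0// ltW.
have := @mean_value_le R d w (fun s => 'd f (p s) (b - a) - 'd f a (b - a))
  (e * `|b - a|) 0 1 ler01.
have -> : w 1 - w 0 = f b - f a - 'd f a (b - a).
  rewrite /w /p !scale0r !scale1r addr0 subr0 addrCA subrr addr0.
  by rewrite addrAC.
rewrite subr0 mulr1; apply.
- move=> s /pr /Hr[Ups _].
  have df : differentiable f (p s) by have [/(_ _ Ups)] := C1f.
  exact: (is_deriveB (is_derive_chain (dp s) df) (is_derive_scalel _ _)).
- move=> s /pr /Hr[_ /(_ (b - a)) H1].
  have [_ /(_ (b - a)) H2] := Hr a ar.
  apply: (le_trans (ler_distD ('d f u0 (b - a)) _ _)).
  rewrite [leRHS](_ : _ = e / 2 * `|b - a| + e / 2 * `|b - a|); last first.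
    by rewrite -mulrDl -splitr.
  by rewrite distrC in H2; exact: lerD H1 H2.
Unshelve. all: by end_near. Qed.

Lemma C1_bounds u0 : U u0 -> exists r L B, [/\ 0 < r, 0 <= L, 0 <= B &
  [/\ forall x, `|x - u0| <= r -> U x,
      forall x v, `|x - u0| <= r -> `|'d f x v| <= L * `|v|,
      forall x y, `|x - u0| <= r -> `|y - u0| <= r -> `|f x - f y| <= L * `|x - y| &
      forall x, `|x - u0| <= r -> `|f x| <= B]].
Proof.
move=> Uu; have [r1 r10 H1] := C1_diff_near Uu ltr01.
have [r2 r20 H2] := C1_strict Uu ltr01.
pose M := \sum_j `|'d f u0 (delta_mx 0 j)|.
have HM v : `|'d f u0 v| <= M * `|v| by apply: linear_bound => v'; exact: diff_delta.
have M0 : 0 <= M by apply: sumr_ge0.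
pose r := Num.min r1 r2.
have rr1 x : `|x - u0| <= r -> `|x - u0| <= r1 by rewrite le_min => /andP[].
have rr2 x : `|x - u0| <= r -> `|x - u0| <= r2 by rewrite le_min => /andP[].
have r0 : 0 < r by rewrite lt_min r10.
have bd x v : `|x - u0| <= r -> `|'d f x v| <= (M + 1) * `|v|.
  move=> /rr1/H1[_ /(_ v) Hxv]; rewrite mulrDl addrC.
  exact: le_trans (norm_le_sub _ ('d f u0 v)) (lerD Hxv (HM v)).
have lip x y : `|x - u0| <= r -> `|y - u0| <= r -> `|f x - f y| <= (M + 2) * `|x - y|.
  move=> xr yr; have Hxy := H2 _ _ (rr2 _ yr) (rr2 _ xr).
  apply: le_trans (norm_le_sub _ ('d f y (x - y))) _.
  apply: le_trans (lerD Hxy (bd y (x - y) yr)) _.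
  by rewrite -mulrDl addrCA.
have M2 : 0 <= M + 2 by lra.
exists r, (M + 2), (`|f u0| + (M + 2) * r); split; [exact: r0|exact: M2| |].
  by apply: addr_ge0 => //; apply: mulr_ge0; [exact: M2|exact: ltW].
split.
- by move=> x /rr1/H1[].
- move=> x v xr; apply: (le_trans (bd x v xr)).
  by apply: ler_wpM2r; [exact: normr_ge0|rewrite lerD2l ler1n].
- exact: lip.
- move=> x xr; have u0r : `|u0 - u0| <= r by rewrite subrr normr0 ltW.
  apply: le_trans (norm_le_sub (f x) (f u0)) _; rewrite addrC lerD2l.
  by apply: (le_trans (lip x u0 xr u0r)); apply: ler_wpM2l.
Qed.

(** Composing [f] with the retraction onto the ball of radius [r] gives a bounded
    globally Lipschitz field, to which Picard iteration applies; for [T] small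
    its solutions starting in the half ball stay in the ball, where the two fields
    agree. *)
Lemma C1_local_flow u0 : U u0 -> exists r T L, [/\ 0 < r, 0 < T, 0 <= L, L * T <= 2^-1 &
  [/\ forall x, `|x - u0| <= r -> U x,
      forall x v, `|x - u0| <= r -> `|'d f x v| <= L * `|v|,
      forall x y, `|x - u0| <= r -> `|y - u0| <= r -> `|f x - f y| <= L * `|x - y| &
      forall u, `|u - u0| <= r / 2 -> exists2 c : R -> 'rV[R]_d, c 0 = u &
        forall t : R, `|t| < T -> `|c t - u0| <= r /\ is_derive t 1 c (f (c t))]].
Proof.
move=> Uu; have [r [L [B [r0 L0 B0 [rU dL lip bd]]]]] := C1_bounds Uu.
pose cl (x : 'rV[R]_d) : 'rV[R]_d := \row_j clamp (u0 0 j) r (x 0 j).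
have cl_lip x y : `|cl x - cl y| <= `|x - y|.
  apply/rV_norm_leP => // j; rewrite !mxE; apply: le_trans (clamp_dist _ _ _ _) _.
  by have := mx_coord_le (x - y) 0 j; rewrite !mxE.
have cl_in x : `|cl x - u0| <= r.
  by apply/rV_norm_leP => [|j]; [exact: ltW|rewrite !mxE clamp_in// ltW].
have cl_id x : `|x - u0| <= r -> cl x = x.
  move=> xr; apply/rowP => j; rewrite mxE clamp_id//.
  by have := le_trans (mx_coord_le (x - u0) 0 j) xr; rewrite !mxE.
have L1 : 0 < 2 * (L + 1) by lra.
have B1 : 0 < 2 * (B + 1) by lra.
pose T := Num.min (2 * (L + 1))^-1 (r / (2 * (B + 1))).
have T0 : 0 < T by rewrite lt_min invr_gt0 L1 divr_gt0.
have LT : L * T <= 2^-1.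
  have : T <= (2 * (L + 1))^-1 by rewrite ge_min lexx.
  by rewrite -[leRHS]mul1r ler_pdivlMr//; lra.
have BT : B * T <= r / 2.
  have : T <= r / (2 * (B + 1)) by rewrite ge_min lexx orbT.
  by rewrite ler_pdivlMr//; lra.
exists r, T, L; split; [exact: r0|exact: T0|exact: L0|exact: LT|].
split; [exact: rU|exact: dL|exact: lip|] => u ur.
have [|x|c [c0 dc cu]] := @picard R d (f \o cl) L B T u L0 T0 LT.
- by move=> x y; apply: le_trans (lip _ _ _ _) _ => //; rewrite ler_wpM2l.
- exact: bd.
exists c => // t tT.
have ctr : `|c t - u0| <= r.
  by rewrite (le_trans (ler_distD u _ _))//; have := cu t tT; lra.
by split=> //; have := dc t tT; rewrite /= cl_id.
Qed.

End C1_estimates.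

(** * Integral curves and flows on a manifold *)

Lemma is_derive_reparam (R : realType) (V : normedModType R) (c : R -> V)
    (g : R -> R) (t a : R) (v : V) :
  is_derive (g t) 1 c v -> is_derive t 1 g a -> is_derive t 1 (c \o g) (a *: v).
Proof.
move=> [dc dcv] dg; have dc' : differentiable c (g t) by exact/derivable1_diffP.
have := is_derive_chain dg dc'.
by rewrite deriv1E// derive1E dcv.
Qed.

Lemma is_derive_addr (R : realType) (s t : R) : is_derive t (1 : R) (fun r : R => r + s) (1 : R).
Proof.
rewrite -[1 in X in is_derive _ _ _ X]addr0.
exact: (is_deriveD (is_derive_id t 1) (is_derive_cst s t 1)).
Qed.

Section Manifold.
Variables (R : realType) (d : nat) (M : topologicalType).
Variable A : smooth_atlas R d M.
Hypothesis hM : hausdorff_space M.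

Local Notation dom i := (cdom (at_chart A i)).
Local Notation phi i := (cmap (at_chart A i)).
Local Notation psi i := (cinv (at_chart A i)).

(** Being an integral curve is a property of germs; stating it at one time
    allows restricting, translating and gluing curves. *)
Definition integral_at (X : vfield A) (c : R -> M) (t : R) : Prop :=
  {for t, continuous c} /\
  (forall i, dom i (c t) -> is_derive t 1 (phi i \o c) (X (c t) i)).

Lemma integral_curveP (X : vfield A) (c : R -> M) :
  integral_curve X c <-> forall t, integral_at X c t.
Proof.
split=> [[cc dc] t|H]; first by split; [exact: cc|exact: dc].
by split=> t; have [] := H t.
Qed.

Lemma integral_at_near (X : vfield A) (c c' : R -> M) (t : R) : (\forall s \near t, c s = c' s) ->
  integral_at X c t -> integral_at X c' t.
Proof.
move=> E [cc dc]; have Et : c t = c' t by exact: (nbhs_singleton E).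
split; first exact: continuous_near_eq E cc.
move=> i; rewrite -Et => /dc; apply: near_eq_is_derive.
by apply: filterS E => s /= ->.
Qed.

Lemma integral_at_shift (X : vfield A) (c : R -> M) (s t : R) :
  integral_at X c (t + s) -> integral_at X (fun r => c (r + s)) t.
Proof.
move=> [cc dc]; split.
  apply: (@continuous_comp _ _ _ (fun r => r + s) c) => //.
  by apply: cvgD; [exact: cvg_id|exact: cvg_cst].
move=> i /dc H.
rewrite -[X _ _]scale1r.
exact: (@is_derive_reparam _ _ _ (fun r => r + s) t 1 _ H (is_derive_addr s t)).
Qed.

Lemma near_dom i (c : R -> M) (t : R) : {for t, continuous c} -> dom i (c t) ->
  \forall s \near t, dom i (c s).
Proof. by move=> cc di; apply: cc; apply: open_nbhs_nbhs; split=> //; exact: cdom_open. Qed.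

Lemma transition_diff i j p : dom i p -> dom j p ->
  differentiable (transition (at_chart A i) (at_chart A j)) (phi i p).
Proof.
move=> ip jp; have [H _] := @transition_smooth _ _ _ A i j 1%N.
by apply: H; exists p.
Qed.

(** One chart suffices: the compatibility of the coordinates of a tangent
    vector is the chain rule for the transition map. *)
Lemma integral_at_chart (X : vfield A) (c : R -> M) (t : R) i :
  C1_vector_field X -> {for t, continuous c} ->
  dom i (c t) -> is_derive t 1 (phi i \o c) (X (c t) i) -> integral_at X c t.
Proof.
move=> [tX _] cc di dc; split=> // j dj.
have [/(_ i j di dj) -> _] := tX (c t).
have := is_derive_chain dc (transition_diff di dj).
apply: near_eq_is_derive.
by apply: filterS (near_dom cc di) => s ds; rewrite /transition /= cmapK.
Qed.

Lemma integral_at_psi (X : vfield A) i (c : R -> 'rV[R]_d) (t : R) : C1_vector_field X ->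
  (\forall s \near t, (phi i @` dom i) (c s)) ->
  is_derive t 1 c (local_rep X i (c t)) -> integral_at X (psi i \o c) t.
Proof.
move=> C1X nd dc.
have [p ip pE] := nbhs_singleton nd.
apply: (integral_at_chart (i := i)) => //.
- apply: continuous_comp; first exact: is_derive_continuous dc.
  by apply: cinv_continuous; exists p.
- by rewrite /= -pE cmapK.
- apply: near_eq_is_derive dc.
  by apply: filterS nd => s [q iq Eq] /=; rewrite -Eq cmapK.
Qed.

Lemma local_rep_phi (X : vfield A) i p : dom i p -> local_rep X i (phi i p) = X p i.
Proof. by move=> ip; rewrite /local_rep cmapK. Qed.

Lemma chart_img_open i : open (phi i @` dom i).
Proof. exact: cimg_open. Qed.

(** In a chart the difference of the two curves satisfies |w'| <= L |w| and
    vanishes at [t0]. *)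
Lemma near_unique (X : vfield A) (c1 c2 : R -> M) (t0 : R) : C1_vector_field X ->
  (\forall t \near t0, integral_at X c1 t) -> (\forall t \near t0, integral_at X c2 t) ->
  c1 t0 = c2 t0 -> \forall t \near t0, c1 t = c2 t.
Proof.
move=> C1X n1 n2 E; pose i := idx_at A (c1 t0).
have di : dom i (c1 t0) by exact: idx_atP.
have Ud : (phi i @` dom i) (phi i (c1 t0)) by exists (c1 t0).
have [r [L [B [r0 L0 B0 [rU _ lip _]]]]] := C1_bounds (chart_img_open (i := i)) (C1X.2 i) Ud.
have near_chart c : (\forall t \near t0, integral_at X c t) -> c t0 = c1 t0 ->
    \forall t \near t0, [/\ integral_at X c t, dom i (c t) & `|phi i (c t) - phi i (c1 t0)| <= r].
  move=> nc Ec; have [cc _] := nbhs_singleton nc.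
  have dc : dom i (c t0) by rewrite Ec.
  have cpc : {for t0, continuous (phi i \o c)}.
    by apply: continuous_comp => //; exact: cmap_continuous.
  apply: filterS3 nc (near_dom cc dc) (near_dist_lt cpc r0) => t nct dt /ltW.
  by rewrite /= Ec; split.
have [T1 T10 HT1] := @nbhs_norm_le R R^o t0 _
  (filterI (near_chart _ n1 erefl) (near_chart _ n2 (esym E))).
pose T := Num.min T1 (2 * (L + 1))^-1.
have L1 : 0 < 2 * (L + 1) by lra.
have T0 : 0 < T by rewrite lt_min T10 invr_gt0.
have LT : L * T <= 2^-1.
  have : T <= (2 * (L + 1))^-1 by rewrite ge_min lexx orbT.
  by rewrite -[leRHS]mul1r ler_pdivlMr//; lra.
have TT1 : T <= T1 by rewrite ge_min lexx.
have HT t (h : `|t - t0| <= T) := HT1 t (le_trans h TT1).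
have : \forall t \near t0, `|t - t0| <= T.
  by apply: filterS (@near_dist_id R R^o t0 _ T0) => t /ltW.
apply: filterS => t tT.
pose w s := phi i (c1 s) - phi i (c2 s).
have : `|w t| <= 2 * (`|w t0| + 0 * T).
  apply: (small_gronwall (L := L) (K := 0) (T := T)
    (dw := fun s => X (c1 s) i - X (c2 s) i)) tT => //.
  - exact: ltW.
  - move=> s /HT[[i1 d1 _] [i2 d2 _]].
    exact: (is_deriveB (i1.2 _ d1) (i2.2 _ d2)).
  - move=> s /HT[[i1 d1 b1] [i2 d2 b2]].
    by have := lip _ _ b1 b2; rewrite !local_rep_phi// addr0.
rewrite /w E subrr normr0 mul0r addr0 mulr0 normr_le0 subr_eq0 => /eqP Et.
have [[_ d1 _] [_ d2 _]] := HT _ tT.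
by rewrite -(cmapK d1) -(cmapK d2) Et.
Unshelve. all: by end_near. Qed.

Definition solution (X : vfield A) (T : R) (c : R -> M) : Prop :=
  forall t, `|t| < T -> integral_at X c t.

(** The Hausdorff property makes the coincidence of two curves a closed condition
    on time. *)
Lemma near_neq (c1 c2 : R -> M) (t : R) : {for t, continuous c1} ->
  {for t, continuous c2} -> c1 t <> c2 t -> \forall s \near t, c1 s <> c2 s.
Proof.
move=> cc1 cc2 /eqP ne.
move: hM; rewrite open_hausdorff => /(_ _ _ ne)[[U V] /= [Ux Vy] [oU oV UV]].
rewrite inE in Ux; rewrite inE in Vy.
have n1 : \forall s \near t, U (c1 s) by apply: cc1; apply: open_nbhs_nbhs.
have n2 : \forall s \near t, V (c2 s) by apply: cc2; apply: open_nbhs_nbhs.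
apply: filterS2 n1 n2 => s U1 V2 E; move/eqP : UV => UV.
by have : (U `&` V) (c1 s) by [split=> //; rewrite E]; rewrite UV.
Qed.

(** The times of coincidence form a nonempty open and closed subset of ]-T, T[. *)
Lemma solution_unique (X : vfield A) T c1 c2 t :
  C1_vector_field X -> solution X T c1 -> solution X T c2 ->
  c1 0 = c2 0 -> `|t| < T -> c1 t = c2 t.
Proof.
move=> C1X s1 s2 E tT; have T0 : 0 < T by exact: le_lt_trans tT.
pose J := [set t : R | `|t| < T].
have oJ : open J by rewrite openE => s; exact: near_norm_lt.
have cJ : connected J.
  apply/connected_intervalP => x y Jx Jy z /andP[xz zy].
  by move: Jx Jy; rewrite /J /= !ltr_norml; lra.
pose B := [set t | J t /\ c1 t = c2 t].
have nsol c : solution X T c -> forall t, J t -> \forall s \near t, integral_at X c s.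
  by move=> sc s /near_norm_lt; apply: filterS => ? /sc.
suff : B = J by move=> BJ; have : J t by []; rewrite -BJ => -[].
apply: cJ.
- by exists 0; split=> //; rewrite /J /= normr0.
- exists B; last by apply/seteqP; split=> [s [Js Es]|s [_ //]]; split.
  rewrite openE => s [Js Es].
  have n := near_unique C1X (nsol _ s1 _ Js) (nsol _ s2 _ Js) Es.
  by apply: filterS2 n (near_norm_lt Js) => z Ez Jz; split.
- exists (~` [set t | J t /\ c1 t <> c2 t]).
    apply: open_closedC; rewrite openE => s [Js ns].
    have n := near_neq (s1 _ Js).1 (s2 _ Js).1 ns.
    by apply: filterS2 n (near_norm_lt Js) => z Ez Jz; split.
  apply/seteqP; split=> [s [Js Es]|s [Js ns]]; split=> //; first by case.
  by apply: contrapT => ne; apply: ns.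
Qed.

(** The Euclidean flow box of [C1_local_flow] carried to the manifold; its
    estimates in the chart are kept for the proof of commutation. *)
Lemma chart_flow (X : vfield A) (p : M) i : C1_vector_field X -> dom i p ->
  exists r T L, [/\ 0 < r, 0 < T, 0 <= L, L * T <= 2^-1 &
  [/\ forall x, `|x - phi i p| <= r -> (phi i @` dom i) x,
      forall x v, `|x - phi i p| <= r -> `|'d (local_rep X i) x v| <= L * `|v|,
      forall x y, `|x - phi i p| <= r -> `|y - phi i p| <= r ->
        `|local_rep X i x - local_rep X i y| <= L * `|x - y| &
      forall u, `|u - phi i p| <= r / 2 -> exists2 c : R -> 'rV[R]_d, c 0 = u &
        forall t : R, `|t| < T -> [/\ `|c t - phi i p| <= r,
          is_derive t 1 c (local_rep X i (c t)) & integral_at X (psi i \o c) t]]].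
Proof.
move=> C1X dp; have Up : (phi i @` dom i) (phi i p) by exists p.
have [r [T [L [r0 T0 L0 LT [rU dL lip fl]]]]] :=
  C1_local_flow (chart_img_open (i := i)) (C1X.2 i) Up.
exists r, T, L; split; [exact: r0|exact: T0|exact: L0|exact: LT|].
split; [exact: rU|exact: dL|exact: lip|].
move=> u /fl[c c0 Hc]; exists c => // t tT; have [ctr dc] := Hc t tT.
split=> //; apply: integral_at_psi => //.
by apply: filterS (near_norm_lt tT) => s /Hc[/rU].
Qed.

Lemma local_solution (X : vfield A) (p : M) : C1_vector_field X -> exists2 T, 0 < T &
  \forall q \near p, exists2 c, c 0 = q & solution X T c.
Proof.
move=> C1X; have dp := idx_atP A p; set i := idx_at A p in dp.
have [r [T [L [r0 T0 _ _ [_ _ _ fl]]]]] := chart_flow C1X dp.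
exists T => //.
have cphi : {for p, continuous (phi i)} by exact: cmap_continuous.
have r20 : 0 < r / 2 by rewrite divr_gt0.
have ndom : \forall q \near p, dom i q.
  by apply: open_nbhs_nbhs; split=> //; exact: cdom_open.
apply: filterS2 (near_dist_lt cphi r20) ndom => q /ltW/fl[c c0 Hc] dq.
exists (psi i \o c); first by rewrite /= c0 cmapK.
by move=> t /Hc[].
Qed.

Lemma solution_shift (X : vfield A) T S s c : solution X T c -> S + `|s| <= T ->
  solution X S (fun r => c (r + s)).
Proof.
move=> sc ST t tS; apply: integral_at_shift; apply: sc.
by rewrite (le_lt_trans (ler_normD _ _))// (lt_le_trans _ ST)// ltrD2r.
Qed.

Lemma solution_le (X : vfield A) T S c : S <= T -> solution X T c -> solution X S c.
Proof. by move=> ST sc t tS; apply: sc; exact: lt_le_trans ST. Qed.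

(** A curve is followed up to time T/2 on either side, and from there continued
    by the curve issued from the point reached. *)
Lemma solution_extend (X : vfield A) T : C1_vector_field X -> 0 < T ->
  (forall p, exists2 c, c 0 = p & solution X T c) ->
  (forall p, exists2 c, c 0 = p & solution X (3 / 2 * T) c).
Proof.
move=> C1X T0 ET p; have [c0 c00 s0] := ET p.
have /choice[cn Hcn] : forall q : M, exists c, c 0 = q /\ solution X T c.
  by move=> q; have [c ? ?] := ET q; exists c.
pose h (t : R) : R := Num.sg t * (T / 2).
pose c t := if `|t| < T then c0 t else cn (c0 (h t)) (t - h t).
exists c; first by rewrite /c normr0 T0.
(* Near |t| = T the curve may be given by either formula. *)
have overlap a t : `|a| = T / 2 -> `|t - a| < T / 2 -> c0 t = cn (c0 a) (t - a).
  move=> aT taT.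
  have [e1 e2] := Hcn (c0 a).
  have S1 : solution X (T / 2) (fun r => c0 (r + a)).
    by apply: solution_shift s0 _; rewrite aT; lra.
  have S2 : solution X (T / 2) (cn (c0 a)) by apply: solution_le e2; lra.
  have := solution_unique C1X S1 S2 _ taT; rewrite subrK; apply.
  by rewrite add0r e1.
move=> t tT; have [t1|t1] := ltP `|t| T.
  apply: integral_at_near (s0 _ t1).
  by apply: filterS (near_norm_lt t1) => s sT; rewrite /c sT.
pose a := h t.
have tn0 : t != 0 by rewrite -normr_gt0; exact: lt_le_trans t1.
have aT : `|a| = T / 2.
  by rewrite /a /h normrM normr_sg tn0 mul1r ger0_norm//; lra.
have ta : `|t - a| < T.
  rewrite /a /h; move: t1 tT; have [t0|t0|t0] := ltgtP t 0.
  - by rewrite ltr0_sg// ltr0_norm// ltr_norml; lra.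
  - by rewrite gtr0_sg// gtr0_norm// ltr_norml; lra.
  - by move: tn0; rewrite t0 eqxx.
have [e1 e2] := Hcn (c0 a).
apply: (@integral_at_near _ (fun r => cn (c0 a) (r - a))); last first.
  by apply: integral_at_shift; exact: e2.
have ns : \forall s \near t, `|s - t| < T / 2.
  by apply: (@near_dist_id R R^o); lra.
apply: filterS ns => s sT; rewrite /c.
have sgs : Num.sg s = Num.sg t.
  move: t1 sT; have [t0|t0|t0] := ltgtP t 0.
  - by rewrite ltr0_norm// ltr_norml => ? /andP[? ?]; rewrite !ltr0_sg//; lra.
  - by rewrite gtr0_norm// ltr_norml => ? /andP[? ?]; rewrite !gtr0_sg//; lra.
  - by move: tn0; rewrite t0 eqxx.
have hs : h s = a by rewrite /a /h sgs.
case: ltP => s1; last by rewrite hs.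
rewrite (overlap a s)//.
rewrite /a /h; move: t1 sT s1; have [t0|t0|t0] := ltgtP t 0.
- by rewrite ltr0_sg// ltr0_norm// !ltr_norml; lra.
- by rewrite gtr0_sg// gtr0_norm// !ltr_norml; lra.
- by move: tn0; rewrite t0 eqxx.
Qed.

(** The existence time can be multiplied by 3/2 indefinitely; by uniqueness the
    curves obtained are restrictions of a single one. *)
Lemma solution_all (X : vfield A) T : C1_vector_field X -> 0 < T ->
  (forall p, exists2 c, c 0 = p & solution X T c) ->
  forall p, exists2 c, c 0 = p & forall t, integral_at X c t.
Proof.
move=> C1X T0 ET p.
pose S n := (3 / 2) ^+ n * T.
have ES n : forall q, exists2 c, c 0 = q & solution X (S n) c.
  elim: n => [|n IH]; first by rewrite /S expr0 mul1r.
  have -> : S n.+1 = 3 / 2 * S n by rewrite /S exprS mulrA.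
  by apply: solution_extend => //; rewrite /S mulr_gt0// exprn_gt0//; lra.
have /choice[c Hc] : forall n, exists c, c 0 = p /\ solution X (S n) c.
  by move=> n; have [c ? ?] := ES n p; exists c.
have big (t : R) : exists n, `|t| < S n.
  have lin n : n%:R * T / 2 + T <= S n.
    elim: n => [|n IH]; first by rewrite /S expr0; lra.
    have : 0 <= n%:R * T by rewrite mulr_ge0// ltW.
    have -> : S n.+1 = 3 / 2 * S n by rewrite /S exprS mulrA.
    rewrite -natr1; lra.
  exists (Num.truncn (`|t| * 2 / T)).+1.
  have := lin (Num.truncn (`|t| * 2 / T)).+1.
  have := truncnS_gt (`|t| * 2 / T); rewrite ltr_pdivrMr//; lra.
have [N HN] := @choice R nat (fun t n => is_true (`|t| < S n)) big.
have agree n m (t : R) : `|t| < S n -> `|t| < S m -> c n t = c m t.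
  move=> tn tm; have [c1 s1] := Hc n; have [c2 s2] := Hc m.
  apply: (@solution_unique X (Num.min (S n) (S m))) => //.
  - by apply: solution_le s1; rewrite ge_min lexx.
  - by apply: solution_le s2; rewrite ge_min lexx orbT.
  - by rewrite c1 c2.
  - by rewrite lt_min tn.
exists (fun t => c (N t) t); first by case: (Hc (N 0)).
move=> t; apply: integral_at_near ((Hc (N t)).2 t (HN t)).
by apply: filterS (near_norm_lt (HN t)) => s sN; apply: agree.
Qed.

Hypothesis cM : compact [set: M].

Lemma uniform_solution (X : vfield A) : C1_vector_field X ->
  exists2 T, 0 < T & forall p, exists2 c, c 0 = p & solution X T c.
Proof.
move=> C1X; pose P (T : R) (p : M) := exists2 c, c 0 = p & solution X T c.
have [||T T0 HT] := @compact_uniform R M setT P cM.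
- by move=> S T p ST [c c0 sc]; exists c => //; exact: solution_le ST sc.
- by move=> p _; exact: local_solution.
- by exists T => // p; exact: HT.
Qed.

Lemma global_curve_ex (X : vfield A) (p : M) : C1_vector_field X ->
  exists2 c, c 0 = p & forall t, integral_at X c t.
Proof. by move=> C1X; have [T T0 HT] := uniform_solution C1X; exact: solution_all HT p. Qed.

Section Flow.
Variable X : vfield A.
Hypothesis C1X : C1_vector_field X.

(** Identifies [flow], which is defined by choice, with any local solution. *)
Lemma flow_solution T c t : solution X T c -> `|t| < T -> flow X t (c 0) = c t.
Proof.
move=> sc tT; have [e e0 He] := global_curve_ex (c 0) C1X.
rewrite /flow; apply: xget_unique => [|y [e' [/integral_curveP He' e'0 <-]]].
  exists e; split=> //; first exact/integral_curveP.
  by apply: (solution_unique C1X _ sc) tT => // s _; exact: He.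
by apply: (solution_unique C1X _ sc) tT => // s _; exact: He'.
Qed.

Lemma flow_curve c t : (forall s, integral_at X c s) -> flow X t (c 0) = c t.
Proof.
by move=> Hc; apply: (@flow_solution (`|t| + 1)) => [s _|]; [exact: Hc|rewrite ltrDl].
Qed.

Lemma integral_at_flow x t : integral_at X (flow X ^~ x) t.
Proof.
have [c c0 Hc] := global_curve_ex x C1X.
suff -> : flow X ^~ x = c by exact: Hc.
by apply/funext => s; rewrite -c0 flow_curve.
Qed.

Lemma flow0 x : flow X 0 x = x.
Proof. by have [c c0 Hc] := global_curve_ex x C1X; rewrite -{1}c0 flow_curve. Qed.

(** Both sides are integral curves in [s] with the same origin. *)
Lemma flowD s t x : flow X (s + t) x = flow X s (flow X t x).
Proof.
have H r : integral_at X (fun r => flow X (r + t) x) r.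
  exact: (@integral_at_shift X (flow X ^~ x) t r (integral_at_flow x (r + t))).
by have := flow_curve s H; rewrite add0r.
Qed.

Lemma flow_continuous_time x t : {for t, continuous (flow X ^~ x)}.
Proof. by have [] := integral_at_flow x t. Qed.

End Flow.

End Manifold.

(** * Commutation of the flows *)

Lemma C1_strict_compact (R : realType) (d : nat) (U : set 'rV[R]_d)
    (f : 'rV[R]_d -> 'rV[R]_d) (a : R -> 'rV[R]_d) (T e : R) :
  open U -> Ck 1 U f -> 0 < e ->
  (forall s : R, `|s| <= T -> U (a s) /\ {for s, continuous a}) ->
  exists2 del, 0 < del & forall s b, `|s| <= T -> `|b - a s| <= del ->
    `|f b - f (a s) - 'd f (a s) (b - a s)| <= e * `|b - a s|.
Proof.
move=> oU C1f e0 Ha.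
pose P (del : R) (s : R) := forall b, `|b - a s| <= del ->
    `|f b - f (a s) - 'd f (a s) (b - a s)| <= e * `|b - a s|.
have [|s0|del del0 Hdel] := compact_uniform (P := P) (@segment_compact R (- T) T).
- by move=> r r' s rr' H b br; apply: H; exact: le_trans rr'.
- rewrite /= in_itv/= -ler_norml => s0T; have [Us cs] := Ha s0 s0T.
  have [r r0 Hr] := C1_strict oU C1f Us e0.
  have r20 : 0 < r / 2 by rewrite divr_gt0.
  exists (r / 2) => //.
  apply: filterS (near_dist_lt cs r20) => s ss b bs; apply: Hr; first by lra.
  by apply: le_trans (ler_distD (a s) _ _) _; lra.
- exists del => // s b sT bs; apply: Hdel bs.
  by rewrite /= in_itv/= -ler_norml.
Qed.

Section Commute.
Variables (R : realType) (d : nat) (M : topologicalType).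
Variable A : smooth_atlas R d M.
Hypothesis hM : hausdorff_space M.
Hypothesis cM : compact [set: M].

Local Notation dom i := (cdom (at_chart A i)).
Local Notation phi i := (cmap (at_chart A i)).
Local Notation psi i := (cinv (at_chart A i)).

Variables X Y : vfield A.
Hypotheses (C1X : C1_vector_field X) (C1Y : C1_vector_field Y).
Hypothesis XY0 : lie_bracket X Y = (fun _ _ => 0).

Lemma bracket_chart i x : dom i x ->
  'd (local_rep Y i) (phi i x) (X x i) = 'd (local_rep X i) (phi i x) (Y x i).
Proof.
move=> dx; have := congr1 (fun F : vfield A => F x i) XY0.
by rewrite /lie_bracket => /subr0_eq.
Qed.

(** [a] and [b] are the X-curves of q and Y_h(q) in a chart, where X and Y are
    [f] and [g].  As the bracket vanishes, g(a s) solves the equation linearized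
    along [a], so b - a - h g(a) solves it up to the error of linearizing [f] at
    [a], which is o(h). *)
Lemma commute_estimate (f g : 'rV[R]_d -> 'rV[R]_d) (a b : R -> 'rV[R]_d)
    (L T e K h : R) :
  0 <= L -> 0 <= T -> 0 <= e -> 0 <= K -> L * T <= 2^-1 ->
  (forall s : R, `|s| <= T -> is_derive s 1 a (f (a s))) ->
  (forall s : R, `|s| <= T -> is_derive s 1 b (f (b s))) ->
  (forall s : R, `|s| <= T -> differentiable g (a s)) ->
  (forall s : R, `|s| <= T -> 'd g (a s) (f (a s)) = 'd f (a s) (g (a s))) ->
  (forall s v, `|s| <= T -> `|'d f (a s) v| <= L * `|v|) ->
  (forall s : R, `|s| <= T ->
    `|f (b s) - f (a s) - 'd f (a s) (b s - a s)| <= e * (K * `|h|)) ->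
  `|b 0 - a 0 - h *: g (a 0)| <= e * `|h| ->
  forall s : R, `|s| <= T -> `|b s - a s - h *: g (a s)| <= e * (2 + 2 * K * T) * `|h|.
Proof.
move=> L0 T0 e0 K0 LT da db dg br dfL H D0 s sT.
pose D s := b s - a s - h *: g (a s).
pose dD s := f (b s) - f (a s) - h *: 'd g (a s) (f (a s)).
have sub0 t : `|t - 0| <= T -> `|t| <= T by rewrite subr0.
have dDD (t : R) : `|t - 0| <= T -> is_derive t 1 D (dD t).
  move=> /sub0 tT.
  exact: (is_deriveB (is_deriveB (db t tT) (da t tT))
    (is_deriveZ h (is_derive_chain (da t tT) (dg t tT)))).
have ddDD (t : R) : `|t - 0| <= T -> `|dD t| <= L * `|D t| + e * (K * `|h|).
  move=> /sub0 tT; rewrite addrC.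
  have E1 : 'd f (a t) (D t) = 'd f (a t) (b t - a t) - h *: 'd f (a t) (g (a t)).
    by rewrite /D linearB linearZ.
  have N : `|'d f (a t) (b t - a t) - h *: 'd f (a t) (g (a t))| <= L * `|D t|.
    exact: (eq_ind _ (fun v => `|v| <= L * `|D t|) (dfL t (D t) tT) _ E1).
  have alg (x y z w : 'rV[R]_d) : x - y - w = (x - y - z) + (z - w).
    by rewrite addrA subrK.
  have E : dD t = (f (b t) - f (a t) - 'd f (a t) (b t - a t)) +
     ('d f (a t) (b t - a t) - h *: 'd f (a t) (g (a t))).
    exact: (etrans (congr1 (fun v => f (b t) - f (a t) - h *: v) (br t tT)) (alg _ _ _ _)).
  have := lerD (H t tT) N.
  by move: (ler_normD (f (b t) - f (a t) - 'd f (a t) (b t - a t))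
    ('d f (a t) (b t - a t) - h *: 'd f (a t) (g (a t)))); rewrite -E; exact: le_trans.
have eK0 : 0 <= e * (K * `|h|) by rewrite mulr_ge0// mulr_ge0.
have sT' : `|s - 0| <= T by rewrite subr0.
apply: le_trans (small_gronwall L0 eK0 T0 LT dDD ddDD sT') _.
have D0' : `|D 0| <= e * `|h| := D0.
have -> : e * (2 + 2 * K * T) * `|h| = 2 * (e * `|h| + e * (K * `|h|) * T) by ring.
by rewrite ler_pM2l// lerD2r.
Qed.

(** [commute_estimate], for every e, gives the velocity at s = 0 in the chart at
    [p].  The range of [t] does not depend on [q], so that compactness of M can
    be used next. *)
Lemma local_commute (p : M) : exists2 T : R, 0 < T & \forall q \near p,
  forall t : R, `|t| <= T -> integral_at Y (fun s => flow X t (flow Y s q)) 0.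
Proof.
have dp := idx_atP A p; set i := idx_at A p in dp.
have [r [T1 [L [r0 T10 L0 LT1 [rU dL lip fl]]]]] := chart_flow C1X dp.
set f := local_rep X i in dL lip fl; pose g := local_rep Y i.
have oU : open (phi i @` dom i) by exact: chart_img_open.
have C1f : Ck 1 (phi i @` dom i) f by exact: C1X.2.
have r20 : 0 < r / 2 by rewrite divr_gt0.
have stay q : dom i q -> `|phi i q - phi i p| <= r / 2 -> forall t : R, `|t| < T1 ->
    dom i (flow X t q) /\ `|phi i (flow X t q) - phi i p| <= r.
  move=> dq /fl[c c0 Hc] t tT.
  have : flow X t ((psi i \o c) 0) = (psi i \o c) t.
    by apply: (flow_solution hM cM C1X (T := T1)) => // s /Hc[].
  rewrite /= c0 cmapK// => ->; have [ctr _ _] := Hc t tT.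
  by have [x dx E] := rU _ ctr; rewrite -E in ctr *; rewrite cmapK.
have dflow Z (C1Z : C1_vector_field Z) q (t : R) : dom i (flow Z t q) ->
    is_derive t 1 (fun s => phi i (flow Z s q)) (local_rep Z i (phi i (flow Z t q))).
  move=> dt; rewrite local_rep_phi//.
  by have [_ /(_ i dt)] := integral_at_flow hM cM C1Z q t.
pose T := T1 / 2.
have T0 : 0 < T by rewrite divr_gt0.
have TT1 (s : R) : `|s| <= T -> `|s| < T1 by rewrite /T; lra.
have LT : L * T <= 2^-1.
  have : 0 <= L * T1 by rewrite mulr_ge0// ltW.
  by rewrite /T mulrA; lra.
exists T => //.
have cphi : {for p, continuous (phi i)} by exact: cmap_continuous.
have ndom : \forall q \near p, dom i q.
  by apply: open_nbhs_nbhs; split=> //; exact: cdom_open.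
apply: filterS2 (near_dist_lt cphi r20) ndom => q qr dq t tT.
pose a s := phi i (flow X s q).
pose y h := phi i (flow Y h q).
have y0 : y 0 = phi i q by rewrite /y flow0.
have dy : is_derive (0 : R) 1 y (g (phi i q)).
  by rewrite -y0; apply: dflow => //; rewrite flow0.
have cy : {for (0 : R), continuous y} := is_derive_continuous dy.
(* For these h the X-curve of Y_h(q) stays in the chart up to time T1. *)
have nh : \forall h \near (0 : R), dom i (flow Y h q) /\ `|y h - phi i p| <= r / 2.
  have n1 : \forall h \near (0 : R), dom i (flow Y h q).
    by apply: near_dom; [exact: flow_continuous_time|rewrite flow0].
  have e0 : 0 < r / 2 - `|phi i q - phi i p| by rewrite subr_gt0.
  apply: filterS2 n1 (near_dist_lt cy e0) => h dh; rewrite y0 => yh; split=> //.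
  by apply: le_trans (ler_distD (phi i q) _ _) _; lra.
have stay_a s : `|s| <= T -> dom i (flow X s q) /\ `|a s - phi i p| <= r.
  by move=> sT; apply: stay => //; [exact: ltW|exact: TT1].
pose K := 2 * (`|g (phi i q)| + 1).
have K0 : 0 <= K by rewrite /K mulr_ge0// addr_ge0.
have nK : \forall h \near (0 : R), `|y h - phi i q| <= (`|g (phi i q)| + 1) * `|h|.
  have := (is_derive_estP _ _ _).1 dy 1 ltr01; apply: filterS => h.
  rewrite subr0 mul1r y0 mulrDl mul1r => Hh.
  apply: le_trans (norm_le_sub _ (h *: g (phi i q))) _.
  by rewrite normrZ addrC lerD// mulrC.
have key e : 0 < e -> \forall h \near (0 : R), dom i (flow X t (flow Y h q)) /\
  `|phi i (flow X t (flow Y h q)) - a t - h *: g (a t)| <= e * (2 + 2 * K * T) * `|h|.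
  move=> e0.
  have [del del0 Hdel] : exists2 del, 0 < del & forall s b, `|s| <= T ->
      `|b - a s| <= del ->
      `|f b - f (a s) - 'd f (a s) (b - a s)| <= e * `|b - a s|.
    apply: (C1_strict_compact oU C1f e0) => s sT; have [ds _] := stay_a s sT.
    split; first by exists (flow X s q).
    exact: is_derive_continuous (dflow _ C1X q s ds).
  have nsmall : \forall h \near (0 : R), K * `|h| <= del.
    have K1 : 0 < K + 1 by lra.
    have dK : 0 < del / (K + 1) by rewrite divr_gt0.
    apply: filterS (near_dist_id (V := R^o) (0 : R) dK) => h.
    rewrite subr0 ltr_pdivlMr// => ?; have := normr_ge0 h; lra.
  have nD := (is_derive_estP _ _ _).1 dy e e0.
  apply: filterS3 nh (filterI nK nsmall) nD => h [dh yhr] [Kh hdel] Dh.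
  have stay_b s : `|s| <= T -> dom i (flow X s (flow Y h q)) /\
      `|phi i (flow X s (flow Y h q)) - phi i p| <= r.
    by move=> sT; apply: stay => //; exact: TT1.
  split; first by have [] := stay_b t tT.
  pose b s := phi i (flow X s (flow Y h q)).
  have a0 : a 0 = phi i q by rewrite /a flow0.
  have b0 : b 0 = y h by rewrite /b flow0.
  have da (s : R) : `|s| <= T -> is_derive s 1 a (f (a s)).
    by move=> sT; apply: dflow => //; have [] := stay_a s sT.
  have db (s : R) : `|s| <= T -> is_derive s 1 b (f (b s)).
    by move=> sT; apply: dflow => //; have [] := stay_b s sT.
  have ba s : `|s| <= T -> `|b s - a s| <= K * `|h|.
    move=> sT; pose w s := b s - a s.
    have : `|w s| <= 2 * (`|w 0| + 0 * T).
      apply: (@small_gronwall _ _ w (fun s => f (b s) - f (a s)) L 0 0 T) => //.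
      - exact: ltW.
      - by move=> z; rewrite subr0 => zT; exact: (is_deriveB (db z zT) (da z zT)).
      - move=> z; rewrite subr0 addr0 => zT; apply: lip.
          by have [] := stay_b z zT.
        by have [] := stay_a z zT.
      - by rewrite subr0.
    move/le_trans; apply; rewrite mul0r addr0 /w a0 b0 /K -mulrA.
    by rewrite ler_pM2l.
  apply: (@commute_estimate f g a b L T e K h L0 (ltW T0) (ltW e0) K0 LT da db) => //.
  - move=> s sT; have [ds _] := stay_a s sT.
    by have [dg _] := C1Y.2 i; apply: dg; exists (flow X s q).
  - move=> s sT; have [ds _] := stay_a s sT.
    by have := bracket_chart ds; rewrite -!(local_rep_phi _ ds).
  - by move=> s v sT; apply: dL; have [] := stay_a s sT.
  - move=> s sT; have bas := ba s sT.
    apply: le_trans (Hdel s (b s) sT (le_trans bas hdel)) _.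
    by apply: ler_wpM2l; [exact: ltW|exact: bas].
  - by rewrite a0 b0; move: Dh; rewrite y0 subr0.
have dt0 : dom i (flow X t q) by have [] := stay_a t tT.
have dder : is_derive (0 : R) 1 (fun h => phi i (flow X t (flow Y h q))) (g (a t)).
  apply/is_derive_estP => e e0.
  have KT : 0 < 2 + 2 * K * T by rewrite ltr_wpDr// mulr_ge0 ?mulr_ge0// ltW.
  have e1 : 0 < e / (2 + 2 * K * T) by rewrite divr_gt0.
  apply: filterS (key _ e1) => h [_]; rewrite divfK ?gt_eqF// flow0// subr0.
  exact.
apply: (@integral_at_chart _ _ _ _ _ _ _ i) => //.
- have n1 := key 1 ltr01.
  have cc := is_derive_continuous dder.
  have cpsi : {for (phi i (flow X t (flow Y 0 q))), continuous (psi i)}.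
    by apply: cinv_continuous; exists (flow X t (flow Y 0 q)) => //; rewrite flow0.
  have cc2 := continuous_comp cc cpsi.
  apply: continuous_near_eq cc2.
  by apply: filterS n1 => h [dh _] /=; rewrite cmapK.
- by rewrite flow0.
- by rewrite flow0//; move: dder; rewrite /g /a local_rep_phi.
Qed.

Lemma small_commute : exists2 T : R, 0 < T & forall q (t : R), `|t| <= T ->
  integral_at Y (fun s => flow X t (flow Y s q)) 0.
Proof.
pose P (T : R) (q : M) := forall t : R, `|t| <= T ->
  integral_at Y (fun s => flow X t (flow Y s q)) 0.
have [||T T0 HT] := @compact_uniform R M setT P cM.
- by move=> S T p ST H t tS; apply: H; exact: le_trans ST.
- by move=> p _; exact: local_commute.
- by exists T => // q t; exact: HT.
Qed.

(** For small [t], s |-> X_t(Y_s(q)) is an integral curve of Y starting at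
    X_t(q).  For other [t], X_t is an iterate of X_(t/n). *)
Lemma flow_commute (s t : R) (q : M) : flow X t (flow Y s q) = flow Y s (flow X t q).
Proof.
have [T T0 HT] := small_commute.
have small (z : R) : `|z| <= T -> forall s q, flow X z (flow Y s q) = flow Y s (flow X z q).
  move=> zT s' q'; pose c r := flow X z (flow Y r q').
  have Hc r : integral_at Y c r.
    have H0 : integral_at Y (fun u => c (u + r)) (r + - r).
      rewrite subrr.
      have -> : (fun u => c (u + r)) = (fun u => flow X z (flow Y u (flow Y r q'))).
        by apply/funext => u; rewrite /c flowD.
      exact: HT.
    have := integral_at_shift H0.
    have -> : (fun u => c (u + - r + r)) = c by apply/funext => u; rewrite subrK.
    exact.
  by have := flow_curve hM cM C1Y s' Hc; rewrite /c flow0// => ->.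
pose n := (Num.truncn (`|t| / T)).+1.
have nT : `|t / n%:R| <= T.
  rewrite normrM normfV (@ger0_norm _ n%:R)// ler_pdivrMr ?ltr0n// mulrC -ler_pdivrMr//.
  by apply: ltW; exact: truncnS_gt.
have tE : t = n%:R * (t / n%:R) by rewrite mulrC divfK// pnatr_eq0.
rewrite tE; move: (t / n%:R) nT => z zT.
elim: n q {tE} => [|n IH] q; first by rewrite mul0r !flow0.
by rewrite -natr1 mulrDl mul1r !flowD// small// IH.
Qed.

End Commute.

(** * Displacement of points under a flow *)

Import HBNNSimple.

(** The integral of a nonnegative function is a supremum over the simple functions
    below it, and each of those is at most [C] on the unit interval and null
    elsewhere. *)
Lemma integral_le_cst (R : realType) (f : R -> R) (C : R) :
  (forall t, 0 <= f t) -> (forall t, f t <= C) ->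
  (\int[lebesgue_measure]_(t in `[0%R, 1%R]) (f t)%:E <= C%:E)%E.
Proof.
move=> f0 fC; have C0 : 0 <= C := le_trans (f0 0) (fC 0).
have mI : measurable (`[0, 1]%classic : set R) by [].
have IC : (\int[lebesgue_measure]_(t in `[0%R : R, 1%R]) (cst C%:E t) = C%:E)%E.
  by rewrite integral_cst//= lebesgue_measure_itv/= lte01 oppr0 adde0 mule1.
rewrite integral_mkcond ge0_integralTE; last first.
  by move=> t; apply: erestrict_ge0 => s _; rewrite lee_fin.
apply: ge_ereal_sup => _ [h /= Hh <-].
rewrite -integralT_nnsfun -[leRHS]IC [leRHS]integral_mkcond.
apply: ge0_le_integral => //.
- by move=> t _; rewrite lee_fin.
- by apply/measurable_EFinP; exact: measurable_funP.
- by apply/(measurable_restrictT _ _).1.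
- by move=> t _; apply: le_trans (Hh t) _; apply: lee_restrict => s _; rewrite lee_fin.
Qed.

Lemma quadratic_form_le (R : realType) (d : nat) (v : 'rV[R]_d) (G : 'M[R]_d) :
  (v *m G *m v^T) 0 0 <= d%:R * d%:R * (`|v| * `|G| * `|v|).
Proof.
rewrite mxE; apply: le_trans (ler_norm _) _; apply: le_trans (ler_norm_sum _ _ _) _.
have -> : d%:R * d%:R * (`|v| * `|G| * `|v|) =
    \sum_(j < d) \sum_(k < d) `|v| * `|G| * `|v|.
  by rewrite !sumr_const !card_ord -mulrA !mulr_natl.
apply: ler_sum => j _; rewrite mxE normrM.
rewrite -mulr_suml; apply: ler_pM => //; last by rewrite mxE mx_coord_le.
apply: le_trans (ler_norm_sum _ _ _) _; apply: ler_sum => k _.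
by rewrite normrM ler_pM// mx_coord_le.
Qed.

Section Metric.
Variables (R : realType) (d : nat) (M : topologicalType).
Variable A : smooth_atlas R d M.
Hypothesis hM : hausdorff_space M.
Hypothesis cM : compact [set: M].

Local Notation dom i := (cdom (at_chart A i)).
Local Notation phi i := (cmap (at_chart A i)).
Local Notation psi i := (cinv (at_chart A i)).

Variables (g : metric_tensor A) (Y : vfield A).
Hypotheses (hg : riemannian g) (C1Y : C1_vector_field Y).

(** The norm is computed in a chart that depends on the point in an arbitrary
    way.  By invariance of the metric it may be computed in one fixed chart near
    each point, where it is continuous. *)
Lemma field_norm_bounded : exists2 C : R, 0 <= C & forall p, tangent_norm g p (Y p) <= C.
Proof.
pose Q p := let i := idx_at A p in (Y p i *m g p i *m (Y p i)^T) 0 0.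
suff [e e0 He] : exists2 e, 0 < e & forall p, [set: M] p -> e * Q p <= 1.
  exists (Num.sqrt e^-1); first exact: sqrtr_ge0.
  move=> p; rewrite /tangent_norm; apply: ler_wsqrtr.
  by rewrite -[leRHS]mul1r ler_pdivlMr// mulrC; exact: He.
suff [e e0 He] : exists2 e, 0 < e & forall p, [set: M] p -> 0 < e -> e * Q p <= 1.
  by exists e => // p Mp; exact: He.
apply: (compact_uniform (P := fun e p => 0 < e -> e * Q p <= 1)) => //.
  move=> r r' p rr' H r0; have [Q0|/ltW Q0] := leP 0 (Q p).
    by apply: le_trans (H (lt_le_trans r0 rr')); rewrite ler_wpM2r.
  by rewrite (le_trans _ ler01)// mulr_ge0_le0// ltW.
move=> p _; have dp := idx_atP A p; set i := idx_at A p in dp.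
pose v q := local_rep Y i (phi i q); pose G q := g (psi i (phi i q)) i.
have Up : (phi i @` dom i) (phi i p) by exists p.
have cphi : {for p, continuous (phi i)} by exact: cmap_continuous.
have cv : {for p, continuous v}.
  apply: continuous_comp => //; apply: differentiable_continuous.
  by have [H _] := C1Y.2 i; exact: H.
have cG : {for p, continuous G}.
  apply: (@continuous_comp _ _ _ (phi i) (fun u => g (psi i u) i)) => //.
  by have [_ _ _ /(_ i 0%N)] := hg; apply.
pose B := d%:R * d%:R * ((`|v p| + 1) * (`|G p| + 1) * (`|v p| + 1)).
have B0 : 0 <= B by rewrite !mulr_ge0// addr_ge0.
have B1 : 0 < B + 1 by lra.
exists (B + 1)^-1; first by rewrite invr_gt0.
have ndom : \forall q \near p, dom i q.
  by apply: open_nbhs_nbhs; split=> //; exact: cdom_open.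
apply: filterS3 ndom (near_dist_lt cv ltr01) (near_dist_lt cG ltr01) => q dq vq Gq _.
rewrite mulrC ler_pdivrMr// mul1r.
have -> : Q q = (v q *m G q *m (v q)^T) 0 0.
  have dj := idx_atP A q; rewrite /Q; set j := idx_at A q in dj *.
  have [_ _ inv _] := hg.
  rewrite /v /G local_rep_phi// cmapK// (inv q i j)//.
  by have [/(_ q)[/(_ i j dq dj) <- _] _] := C1Y.
apply: le_trans (quadratic_form_le _ _) _.
have vq1 : `|v q| <= `|v p| + 1 by have := norm_le_sub (v q) (v p); lra.
have Gq1 : `|G q| <= `|G p| + 1 by have := norm_le_sub (G q) (G p); lra.
apply: (@le_trans _ _ B); last by lra.
by rewrite /B ler_wpM2l ?mulr_ge0// ler_pM ?mulr_ge0// ler_pM.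
Qed.

(** The Y-orbit itself, run from time 0 to time [s], is a path of length at most
    C |s|. *)
Lemma flow_dist_le : exists2 C : R, 0 <= C & forall p s,
  (riemannian_dist g p (flow Y s p) <= (C * `|s|)%:E)%E.
Proof.
have [C C0 HC] := field_norm_bounded; exists C => // p s.
pose c t := flow Y (s * t) p.
have dst (t : R) : is_derive t 1 (fun t : R => s * t) s.
  have := is_deriveZ s (is_derive_id t (1 : R)).
  by rewrite [_ *: _]mulr1; exact.
have cc : continuous c.
  move=> t; apply: (@continuous_comp _ _ _ (fun t : R => s * t) (flow Y ^~ p)).
    exact: is_derive_continuous (dst t).
  exact: flow_continuous_time.
have dc (t : R) i : dom i (c t) -> is_derive t 1 (phi i \o c) (s *: Y (c t) i).
  move=> di; have [_ /(_ i di)] := integral_at_flow hM cM C1Y p (s * t).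
  move=> H; exact: (@is_derive_reparam _ _ _ (fun t => s * t) t s _ H (dst t)).
have C1c : C1_curve A c.
  split=> // t i di; split; first by have [] := dc t i di.
  have nd := near_dom (cc t) di.
  have E : \forall r \near t, s *: local_rep Y i (phi i (c r)) = derive1 (phi i \o c) r.
    apply: filterS nd => r dr; rewrite local_rep_phi// derive1E.
    by have [_ ->] := dc r i dr.
  have cr : {for t, continuous (fun r => s *: local_rep Y i (phi i (c r)))}.
    have cf : {for phi i (c t), continuous (local_rep Y i)}.
      apply: differentiable_continuous.
      by have [H _] := C1Y.2 i; apply: H; exists (c t).
    have cp : {for t, continuous (phi i \o c)} := is_derive_continuous (dc t i di).
    apply: (@continuous_comp _ _ _ (local_rep Y i \o (phi i \o c)) ( *:%R s)).
      exact: (continuous_comp cp cf).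
    exact: (@scaler_continuous R 'rV[R]_d).
  exact: continuous_near_eq E cr.
have Pc : piecewise_C1_path A p (flow Y s p) c.
  split; [by rewrite /c mulr0 flow0|by rewrite /c mulr1|].
  exists [:: 1]; first by split=> //=; rewrite ?ltr01 ?eqxx.
  by move=> k _; exists c.
have Hin : [set path_length g e | e in piecewise_C1_path A p (flow Y s p)] (path_length g c).
  by exists c.
apply: le_trans (ereal_inf_lbound Hin) _.
rewrite /path_length; apply: integral_le_cst => t; first exact: sqrtr_ge0.
have dj := idx_atP A (c t).
rewrite /tangent_norm /velocity; set j := idx_at A (c t) in dj *.
rewrite asboolT// derive1E; have [_ ->] := dc t j dj.
rewrite -!scalemxAl linearZ/= -scalemxAr scalerA mxE -expr2 sqrtrM ?sqr_ge0//.
by rewrite sqrtr_sqr mulrC ler_wpM2r//; exact: HC.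
Qed.

End Metric.

(** * The centralizer of a separating transitive field *)

(** An injection into the integers would make the interval countable, hence of
    measure zero. *)
Lemma interval_pigeonhole (R : realType) (a : R) (m : R -> int) : 0 < a ->
  exists s s', [/\ 0 < s < a, 0 < s' < a, s != s' & m s = m s'].
Proof.
move=> a0; apply: contrapT => H.
have cI : countable (`]0, a[%classic : set R).
  apply/countable_injP; exists (pickle \o m) => s s'; rewrite !inE/= !in_itv/=.
  move=> sI s'I /(pcan_inj (@pickleK int)) E; apply: contrapT => /eqP ns.
  by apply: H; exists s, s'.
have := countable_lebesgue_measure0 cI.
rewrite lebesgue_measure_itv/= lte_fin a0 oppr0 adde0 => /eqP.
by rewrite eqe gt_eqF.
Qed.

Lemma abs_sub_floor (R : realType) (e x y : R) : 0 < e ->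
  Num.floor (x / e) = Num.floor (y / e) -> `|x - y| < e.
Proof.
move=> e0 E.
have H z : (Num.floor (z / e))%:~R * e <= z < ((Num.floor (z / e))%:~R + 1) * e.
  rewrite -ler_pdivlMr// -ltr_pdivrMr// floor_le_tmp/=.
  by have := floorD1_gt (z / e); rewrite intrD.
by have := H x; have := H y; rewrite E ltr_norml; lra.
Qed.

Section Final.
Variables (R : realType) (d : nat) (M : topologicalType).
Variable A : smooth_atlas R d M.
Hypothesis hM : hausdorff_space M.
Hypothesis cM : compact [set: M].

Local Notation dom i := (cdom (at_chart A i)).
Local Notation phi i := (cmap (at_chart A i)).
Local Notation psi i := (cinv (at_chart A i)).

Variables (g : metric_tensor A) (X : vfield A).
Hypotheses (hg : riemannian g) (C1X : C1_vector_field X).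
Hypothesis sepX : separating_field g X.

(** Otherwise the orbit is a point; being closed and dense it is all of M,
    whereas a chart has a nonempty open image in a space of positive dimension. *)
Lemma zero_dense_orbit (x0 : M) : (0 < d)%N -> dense (flow_orbit X x0) ->
  X x0 (idx_at A x0) != 0.
Proof.
move=> d0 dX; apply/negP => /eqP X0; set i := idx_at A x0 in X0.
have dx0 : dom i x0 by exact: idx_atP.
have fix0 t : flow X t x0 = x0.
  have Hc : forall s, integral_at X (fun _ => x0) s.
    move=> s; apply: (@integral_at_chart _ _ _ _ _ _ _ i) => //; first exact: cvg_cst.
    by rewrite X0; exact: is_derive_cst.
  exact: (flow_curve hM cM C1X t Hc).
have all_x0 (x : M) : x = x0.
  apply: contrapT => nx.
  have oC : open (~` [set x0]).
    by apply: closed_openC; apply: accessible_closed_set1; exact: hausdorff_accessible.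
  have ne : (~` [set x0]) !=set0 by exists x.
  have [y [ny [t _ ty]]] := dX _ ne oC.
  by apply: ny; rewrite -ty fix0.
have nU : nbhs (phi i x0) (phi i @` dom i).
  by apply: open_nbhs_nbhs; split; [exact: chart_img_open|exists x0].
have [r r0 Hr] := nbhs_norm_le nU.
have [|x _ +] := Hr (phi i x0 + const_mx r).
  rewrite addrAC subrr add0r; apply/rV_norm_leP => [|j]; first exact: ltW.
  by rewrite mxE gtr0_norm.
rewrite (all_x0 x) => /rowP/(_ (Ordinal d0)); rewrite !mxE => E.
by move: r0; rewrite -(ltrD2l (phi i x0 0 (Ordinal d0))) -E addr0 ltxx.
Qed.

Section Commuting.
Variable Y : vfield A.
Hypothesis C1Y : C1_vector_field Y.
Hypothesis XY0 : lie_bracket X Y = (fun _ _ => 0).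

(** X_t(Y_s(x)) = Y_s(X_t(x)) is at distance at most C |s| from X_t(x), for
    all t. *)
Lemma commuting_orbit (x : M) : exists2 del : R, 0 < del &
  forall s : R, `|s| < del -> exists t, flow Y s x = flow X t x.
Proof.
have [eps eps0 Hsep] := sepX.
have [C C0 HC] := flow_dist_le hM cM hg C1Y.
have C1 : 0 < C + 1 by lra.
exists (eps / (C + 1)); first by rewrite divr_gt0.
move=> s; rewrite ltr_pdivlMr// => sC.
have [|t _ <-] := Hsep x (flow Y s x); last by exists t.
move=> t; rewrite (flow_commute hM cM C1X C1Y XY0).
apply: (le_lt_trans (HC _ _)); rewrite lte_fin.
have := normr_ge0 s; lra.
Qed.

(** Pairs (s, t) with Y_s(x) = X_t(x) form a subgroup of the plane, because the
    flows commute; it is not discrete, as its projection to the first axis contains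
    an interval.  Pairs of this subgroup satisfy the same relation at all the points
    of the X-orbit. *)
Lemma small_coincidence (x : M) (e : R) : 0 < e -> exists s t : R,
  [/\ s != 0, `|s| < e, `|t| < e & forall r,
     flow Y s (flow X r x) = flow X t (flow X r x)].
Proof.
move=> e0; have [del del0 Hdel] := commuting_orbit x.
have /choice[tau Htau] : forall s : R, exists t, `|s| < del -> flow Y s x = flow X t x.
  move=> s; have [/Hdel[t ->]|] := boolP (`|s| < del); first by exists t.
  by exists 0.
pose a := Num.min del e.
have a0 : 0 < a by rewrite lt_min del0.
have [s [s' [sI s'I ns E]]] := interval_pigeonhole (fun s => Num.floor (tau s / e)) a0.
have in_del z : 0 < z < a -> `|z| < del.
  by move=> /andP[z0]; rewrite lt_min gtr0_norm// => /andP[].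
have sab : `|s - s'| < e.
  by move: sI s'I; rewrite !lt_min ltr_norml; lra.
exists (s - s'), (tau s - tau s'); split=> //; first by rewrite subr_eq0.
  exact: abs_sub_floor E.
have cXY := flow_commute hM cM C1X C1Y XY0.
have H' : flow Y (- s') x = flow X (- tau s') x.
  have := congr1 (fun y => flow X (- tau s') (flow Y (- s') y)) (Htau s' (in_del _ s'I)).
  by rewrite /= -!flowD// addNr flow0// -cXY -!flowD// addNr flow0// => ->.
move=> r; rewrite -cXY (addrC s) (flowD hM cM C1Y) (Htau s (in_del _ sI)) -cXY H'.
by rewrite -!flowD//; congr (flow X _ x); lra.
Qed.

Lemma first_order (x : M) i (e : R) : dom i x -> 0 < e -> exists2 eta : R, 0 < eta &
  forall s t : R, `|s| < eta -> `|t| < eta -> flow Y s x = flow X t x ->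
    `|s *: Y x i - t *: X x i| <= e * (`|s| + `|t|).
Proof.
move=> dx e0.
have est Z : C1_vector_field Z -> \forall s \near (0 : R),
    `|phi i (flow Z s x) - phi i x - s *: Z x i| <= e * `|s|.
  move=> C1Z.
  have [_ /(_ i)] := integral_at_flow hM cM C1Z x 0; rewrite flow0// => /(_ dx).
  move=> /is_derive_estP/(_ e e0); apply: filterS => s /=.
  by rewrite flow0// subr0.
have [r1 r10 H1] := @nbhs_norm_le R R^o _ _ (est Y C1Y).
have [r2 r20 H2] := @nbhs_norm_le R R^o _ _ (est X C1X).
exists (Num.min r1 r2); first by rewrite lt_min r10.
move=> s t; rewrite !lt_min => /andP[s1 _] /andP[_ t2] E.
have /H1 : `|s - 0| <= r1 by rewrite subr0 ltW.
have /H2 : `|t - 0| <= r2 by rewrite subr0 ltW.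
rewrite E; set u := phi i _ - phi i x => Ht Hs.
have -> : s *: Y x i - t *: X x i = (u - t *: X x i) - (u - s *: Y x i).
  by apply/rowP => j; rewrite !mxE; ring.
by rewrite (le_trans (ler_normB _ _))// mulrDr addrC lerD.
Qed.

(** The coordinate [k] at [x0] shows that t / s tends to [c] along the small
    coincidences; dividing s Y(x) - t X(x) = o(|s| + |t|) by s then gives the claim
    at each point x of the orbit, with the same [c]. *)
Lemma proportional_on_orbit (x0 : M) i0 k : dom i0 x0 -> X x0 i0 0 k != 0 ->
  forall r i, dom i (flow X r x0) ->
  Y (flow X r x0) i = (Y x0 i0 0 k / X x0 i0 0 k) *: X (flow X r x0) i.
Proof.
move=> dx0 Xk r i; set x := flow X r x0 => dx; set c := _ / _.
pose m := `|X x0 i0 0 k|; have m0 : 0 < m by rewrite normr_gt0.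
apply/eqP; rewrite -subr_eq0 -normr_le0.
apply: (@le_of_le_eps R ((2 * `|c| + 2) * (1 + `|X x i| / m))) => e e0; rewrite add0r.
(* The bound m / 2 lets the term in |t| be absorbed, giving |t| = O(|s|). *)
pose e1 := Num.min e (m / 2).
have e10 : 0 < e1 by rewrite lt_min e0 divr_gt0.
have e1e : e1 <= e by rewrite ge_min lexx.
have e1m : e1 <= m / 2 by rewrite ge_min lexx orbT.
have [eta0 eta00 H0] := first_order dx0 e10.
have [eta1 eta10 H1] := first_order dx e10.
have eta : 0 < Num.min eta0 eta1 by rewrite lt_min eta00.
have [s [t [s0]]] := small_coincidence x0 eta.
rewrite !lt_min => /andP[s_0 s_1] /andP[t_0 t_1] Hst.
have {}H0 := H0 s t s_0 t_0 _.
have {}H0 : `|s *: Y x0 i0 - t *: X x0 i0| <= e1 * (`|s| + `|t|).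
  by apply: H0; have := Hst 0; rewrite flow0.
have {}H1 : `|s *: Y x i - t *: X x i| <= e1 * (`|s| + `|t|) by exact: H1 (Hst r).
have Hk : `|s * c - t| * m <= e1 * (`|s| + `|t|).
  apply: le_trans H0; apply: le_trans (mx_coord_le _ 0 k).
  rewrite -normrM mulrBl -mulrA /c divfK// !mxE.
  exact: lexx.
have s0' : 0 < `|s| by rewrite normr_gt0.
have tb : `|t| <= (2 * `|c| + 1) * `|s|.
  have := norm_le_sub (V := R^o) t (s * c); rewrite distrC normrM => Ht.
  have : `|t| * m <= (`|s * c - t| + `|s| * `|c|) * m by rewrite ler_wpM2r// ltW.
  have : e1 * (`|s| + `|t|) <= m / 2 * (`|s| + `|t|) by rewrite ler_wpM2r// addr_ge0.
  move=> h1 h2; rewrite -(ler_pM2r m0); lra.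
have bound : e1 * (`|s| + `|t|) <= e * (2 * `|c| + 2) * `|s|.
  rewrite -mulrA; apply: ler_pM; [exact: ltW|exact: addr_ge0|exact: e1e|lra].
have Hk' : `|t - s * c| <= e * (2 * `|c| + 2) * `|s| / m.
  by rewrite ler_pdivlMr// distrC (le_trans Hk).
rewrite -(ler_pM2l s0') -normrZ.
have -> : s *: (Y x i - c *: X x i) =
    (s *: Y x i - t *: X x i) + (t - s * c) *: X x i.
  by apply/rowP => j; rewrite !mxE; ring.
apply: le_trans (ler_normD _ _) _; rewrite normrZ.
have : `|t - s * c| * `|X x i| <= e * (2 * `|c| + 2) * `|s| / m * `|X x i|.
  by rewrite ler_wpM2r.
have := le_trans H1 bound.
have -> : `|s| * ((2 * `|c| + 2) * (1 + `|X x i| / m) * e) =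
   e * (2 * `|c| + 2) * `|s| + e * (2 * `|c| + 2) * `|s| / m * `|X x i| by field; rewrite gt_eqF.
by move=> h1 h2; rewrite lerD.
Qed.

Lemma proportional (x0 : M) (c : R) : dense (flow_orbit X x0) ->
  (forall r i, dom i (flow X r x0) -> Y (flow X r x0) i = c *: X (flow X r x0) i) ->
  Y = scale_field c X.
Proof.
move=> dX H; apply/funext => p; apply/funext => i; rewrite /scale_field.
have [dp|ndp] := pselect (dom i p); last first.
  have [_ /(_ i ndp) ->] := C1Y.1 p; have [_ /(_ i ndp) ->] := C1X.1 p.
  by rewrite scaler0.
pose w q := local_rep Y i (phi i q) - c *: local_rep X i (phi i q).
have cloc Z : C1_vector_field Z -> {for p, continuous (fun q => local_rep Z i (phi i q))}.
  move=> C1Z; apply: (@continuous_comp _ _ _ (phi i) (local_rep Z i)).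
    exact: cmap_continuous.
  apply: differentiable_continuous.
  by have [h _] := C1Z.2 i; apply: h; exists p.
have cw : {for p, continuous w}.
  apply: cvgB; first exact: cloc.
  apply: (@continuous_comp _ _ _ (fun q => local_rep X i (phi i q)) ( *:%R c)).
    exact: cloc.
  exact: (@scaler_continuous R 'rV[R]_d).
apply/eqP; rewrite -subr_eq0 -normr_le0 leNgt; apply/negP => w0.
have ndom : \forall q \near p, dom i q.
  by apply: open_nbhs_nbhs; split=> //; exact: cdom_open.
have nw : \forall q \near p, w q <> 0.
  apply: filterS (near_dist_lt cw w0) => q qw q0; move: qw.
  by rewrite q0 sub0r normrN /w !local_rep_phi// ltxx.
have : nbhs p [set q | dom i q /\ w q <> 0] by apply: filterS2 ndom nw.
rewrite nbhsE => -[B [opB Bp] sB].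
have [q [Oq [t _ tq]]] : B `&` flow_orbit X x0 !=set0 by apply: dX => //; exists p.
have [dq wq] := sB _ Oq; apply: wq.
by move: dq; rewrite -tq => dq; rewrite /w !local_rep_phi// H// subrr.
Qed.

End Commuting.

Lemma scale_centralizer (c : R) : C1_centralizer X (scale_field c X).
Proof.
have dZ i u : (phi i @` dom i) u ->
    'd (local_rep (scale_field c X) i) u = c \*: 'd (local_rep X i) u :> (_ -> _).
  move=> Uu; have [h _] := C1X.2 i.
  exact: (diffZ c (h u Uu)).
split; first split.
- move=> p; have [h1 h2] := C1X.1 p; split.
    by move=> i j di dj; rewrite /scale_field (h1 i j di dj) linearZ.
  by move=> i ndi; rewrite /scale_field h2// scaler0.
- move=> i; have [h1 h2] := C1X.2 i; split.
    by move=> u Uu; exact: (differentiableZ c (h1 u Uu)).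
  move=> v u Uu.
  have cu : {for u, continuous (fun x => c *: 'd (local_rep X i) x v)}.
    apply: (@continuous_comp _ _ _ (fun x => 'd (local_rep X i) x v) ( *:%R c)).
      exact: h2.
    exact: (@scaler_continuous R 'rV[R]_d).
  apply: continuous_near_eq cu.
  have nU : nbhs u (phi i @` dom i).
    by apply: open_nbhs_nbhs; split=> //; exact: chart_img_open.
  by apply: filterS nU => x Ux; exact: (esym (congr1 (fun h => h v) (dZ i x Ux))).
- apply/funext => p; apply/funext => i; rewrite /lie_bracket.
  have [dp|ndp] := pselect (dom i p); last first.
    have [_ h] := C1X.1 p; rewrite /scale_field h// scaler0.
    have lin0 (f : 'rV[R]_d -> 'rV[R]_d) (u : 'rV[R]_d) : 'd f u 0 = 0 by exact: linear0.
    have e0 := etrans (lin0 (local_rep (scale_field c X) i) (phi i p))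
      (esym (lin0 (local_rep X i) (phi i p))).
    by apply/eqP; rewrite subr_eq0; apply/eqP; exact: e0.
  have Up : (phi i @` dom i) (phi i p) by exists p.
  have e1 := congr1 (fun h => h (X p i)) (dZ i (phi i p) Up).
  have e2 : 'd (local_rep X i) (phi i p) (c *: X p i) =
    c *: 'd (local_rep X i) (phi i p) (X p i) by rewrite linearZ.
  apply/eqP; rewrite subr_eq0; apply/eqP; exact: (etrans e1 (esym e2)).
Qed.

End Final.

Theorem theoremD (R : realType) (d : nat) (M : topologicalType)
    (A : smooth_atlas R d M) (g : metric_tensor A) (X : vfield A)
    (hd : (2 <= d)%N)
    (hM_hausdorff : hausdorff_space M)
    (hM_compact : compact [set: M])
    (hg : riemannian g)
    (hX : C1_vector_field X)
    (hX_trans : transitive_field X)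
    (hX_sep : separating_field g X) :
  C1_centralizer X = [set scale_field c X | c in [set: R]].
Proof.
apply/seteqP; split=> [Y [C1Y XY0]|_ [c _ <-]]; last exact: scale_centralizer.
have [x0 dX] := hX_trans.
have X0 := zero_dense_orbit hM_hausdorff hM_compact hX (ltnW hd) dX.
have [k Xk] : exists k, X x0 (idx_at A x0) 0 k != 0.
  by move/rV0Pn : X0.
eexists; first by [].
symmetry; apply: (proportional hX C1Y dX).
exact: (proportional_on_orbit hM_hausdorff hM_compact hg hX hX_sep C1Y XY0
  (idx_atP A x0) Xk).
Qed.
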